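(* Let $u:[t_0,t_1]\to U_h^{\rm grad}$ and $\rho,s:[t_0,t_1]\to V_h$ be smooth curves solving the spatially discrete system $$\Big\langle\partial_t\frac{\delta\ell}{\delta u},v\Big\rangle+a\Big(\pi_h\frac{\delta\ell}{\delta u},u,v\Big)+b_h\Big(\pi_h\frac{\delta\ell}{\delta\rho},\rho,v\Big)+b_h\Big(\pi_h\frac{\delta\ell}{\delta s},s,v\Big)=-c(1,u,v),\quad\forall v\in U_h^{\rm grad},$$ $$\langle\partial_t\rho,\theta\rangle+b_h(\theta,\rho,u)=0,\quad\forall\theta\in V_h,$$ $$-\Big\langle\partial_ts,\pi_h\Big(\frac{\delta\ell}{\delta s}\Big)w\Big\rangle-b_h\Big(\pi_h\Big(\pi_h\Big(\frac{\delta\ell}{\delta s}\Big)w\Big),s,u\Big)+d_h\Big(1,-\pi_h\frac{\delta\ell}{\delta s},\pi_h\Big(\pi_h\Big(\frac{\delta\ell}{\delta s}\Big)w\Big)\Big)$$ $$\qquad=c(w,u,u)+d_h\Big(w,-\pi_h\frac{\delta\ell}{\delta s},\pi_h\frac{\delta\ell}{\delta s}\Big)-e_h\Big(w,-\pi_h\frac{\delta\ell}{\delta s}\Big),\quad\forall w\in V_h .$$ Then the total energy $\mathcal E=\big\langle\frac{\delta\ell}{\delta u},u\big\rangle-\ell(u,\rho,s)$ and the total mass satisfy $$\frac{d}{dt}\mathcal E=-e_h\Big(1,-\pi_h\frac{\delta\ell}{\delta s}\Big),\qquad\frac{d}{dt}\int_\Omega\rho\,dx=0 .$$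
   Context: $\Omega\subset\mathbb R^d$, $d\in\{2,3\}$, is a bounded domain with a conforming simplicial triangulation $\mathcal T_h$; $\mathcal E_h^0$ is the set of interior codimension-1 faces. $V_h=\{f\in L^2(\Omega):f|_K\in P_q(K)\ \forall K\in\mathcal T_h\}$, $U_h^{\rm grad}=\{u\in H_0^1(\Omega)^d:u|_K\in P_r(K)^d\ \forall K\in\mathcal T_h\}$ with $1\le r\le q$ ($P_q$ = polynomials of degree $\le q$). $\langle\cdot,\cdot\rangle$ is the $L^2(\Omega)$ inner product and $\pi_h:L^2(\Omega)\to V_h$ the $L^2$-orthogonal projector (componentwise on vector fields). On $e=K_1\cap K_2\in\mathcal E_h^0$: $\llbracket f\rrbracket=f_1n_1+f_2n_2$, $\{f\}=\frac12(f_1+f_2)$, with $f_i=f|_{K_i}$ and $n_i$ the unit normal to $e$ pointing outward from $K_i$. $\nabla_uf=u\cdot\nabla f$, $[u,v]=u\cdot\nabla v-v\cdot\nabla u$. $\ell(u,\rho,s)$ is a given (smooth) fluid Lagrangian with functional derivatives taken with respect to the $L^2$ pairing, e.g. $\frac{d}{d\varepsilon}\big|_{\varepsilon=0}\ell(u+\varepsilon\delta u,\rho,s)=\int_\Omega\frac{\delta\ell}{\delta u}\cdot\delta u\,dx$; they are evaluated at $(u,\rho,s)$. Forms: $a(w,u,v)=-\int_\Omega w\cdot[u,v]\,dx$; $b_h(f,\rho,u)=-\sum_{K\in\mathcal T_h}\int_K(\nabla_uf)\rho\,dx+\sum_{e\in\mathcal E_h^0}\int_eu\cdot\llbracket f\rrbracket\{\rho\}\,da$;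 $c(w,u,v)=\int_\Omega w\,\sigma(u):\nabla v\,dx$ with $\sigma(u)=2\mu\,\mathrm{Def}\,u+\lambda(\mathrm{div}\,u)\delta$, $\mathrm{Def}\,u=\frac12(\nabla u+\nabla u^{\mathsf T})$, $\delta$ the identity tensor, $\mu\ge0$ and $\lambda+\frac2d\mu\ge0$ constants. $d_h:V_h\times V_h\times V_h\to\mathbb R$ is a given map that is linear in its first and third arguments, and $e_h:V_h\times V_h\to\mathbb R$ is a given map linear in its first argument. *)

(* Defs.v *)
From HB Require Import structures.
From mathcomp Require Import all_boot all_order all_algebra.
From mathcomp Require Import all_classical all_reals all_analysis.

Set Implicit Arguments.
Unset Strict Implicit.
Unset Printing Implicit Defensive.

Import Order.TTheory GRing.Theory Num.Theory.
Import numFieldNormedType.Exports.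

Local Open Scope classical_set_scope.
Local Open Scope ring_scope.

(* Points of R^n are row vectors; the sigma-algebra is generated by the
   coordinates, as the library does for [n.-tuple T]. *)
Section measurable_rV.
Context {disp : measure_display} {T : measurableType disp} (n : nat).

Let coor (i : 'I_n) (x : 'rV[T]_n) : T := x 0 i.

Let rV_set0 : g_sigma_preimage coor set0.
Proof. exact: sigma_algebra0. Qed.

Let rV_setC A : g_sigma_preimage coor A -> g_sigma_preimage coor (~` A).
Proof. exact: sigma_algebraC. Qed.

Let rV_bigcup (F : (set 'rV[T]_n)^nat) :
  (forall i, g_sigma_preimage coor (F i)) ->
  g_sigma_preimage coor (\bigcup_i (F i)).
Proof. exact: sigma_algebra_bigcup. Qed.

HB.instance Definition _ := @isMeasurable.Build (measure_tuple_display disp)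
  'rV[T]_n (g_sigma_preimage coor) rV_set0 rV_setC rV_bigcup.

Lemma measurable_coor (i : 'I_n) :
  measurable_fun setT (fun x : 'rV[T]_n => x 0 i).
Proof.
move=> _ A mA; rewrite setTI; apply: sub_sigma_algebra.
rewrite -bigcup_seq; exists i; first by rewrite /= mem_index_enum.
by exists A => //; rewrite setTI.
Qed.

Lemma measurable_fun_rV d' (U : measurableType d') (f : U -> 'rV[T]_n) :
  (forall i, measurable_fun setT (fun u => f u 0 i)) -> measurable_fun setT f.
Proof.
move=> mf; apply: (@measurability _ _ _ _ setT f
  (\big[setU/set0]_(i < n) preimage_set_system setT (coor i) measurable)) => //.
move=> _ [B + <-]; rewrite -bigcup_seq => -[i _ [C mC <-]].
by rewrite !setTI; have := mf i measurableT C mC; rewrite setTI.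
Qed.
End measurable_rV.

Section lebesgue_rV.
Variable R : realType.

Definition rV_snoc n (p : 'rV[R]_n * R) : 'rV[R]_n.+1 :=
  \row_i oapp (fun j : 'I_n => p.1 0 j) p.2 (unlift ord_max i).

Lemma measurable_rV_snoc n : measurable_fun setT (@rV_snoc n).
Proof.
apply: measurable_fun_rV => i; under eq_fun do rewrite mxE.
case: unliftP => [j _|_] /=; last exact: measurable_snd.
by apply: (measurableT_comp (measurable_coor j)); exact: measurable_fst.
Qed.

Let snoc_measure n (m : {measure set 'rV[R]_n -> \bar R}) :
  {measure set 'rV[R]_n.+1 -> \bar R} :=
  measure_function_pushforward__canonical__measure_function_Measure
    (m \x (@lebesgue_measure R))%E (@measurable_rV_snoc n).

(* Obtained by iterating the product with the one-dimensional measure. *)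
Fixpoint lebesgue_rV n : {measure set 'rV[R]_n -> \bar R} :=
  if n is n'.+1 then snoc_measure (lebesgue_rV n')
  else dirac (0 : 'rV[R]_0).
End lebesgue_rV.

(* A scalar field is a total function on R^d, a vector field is the family of
   its components.  Elements of L^2(Omega) are represented by such
   functions, and only matter up to equality almost everywhere in Omega. *)
Notation sfield R d := ('rV[R]_d -> R) (only parsing).
Notation vfield R d := ('I_d -> 'rV[R]_d -> R) (only parsing).

Section function_spaces.
Variables (R : realType) (d : nat) (Omega : set 'rV[R]_d).
Local Notation mu := (lebesgue_rV R d).
Implicit Types (f g phi : sfield R d) (u v : vfield R d).

Definition L2 f : Prop :=
  measurable_fun Omega f /\ mu.-integrable Omega (fun x => ((f x) ^+ 2)%:E).

Definition ip f g : R := \int[mu]_(x in Omega) (f x * g x).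

Definition vip u v : R := \sum_i ip (u i) (v i).

Definition L2norm f : R := Num.sqrt (ip f f).

Definition aeq f g : Prop := {ae mu, forall x, Omega x -> f x = g x}.

Definition partial (i : 'I_d) f : sfield R d := fun x => 'D_(delta_mx 0 i) f x.

Fixpoint Ck k f : Prop :=
  if k is k'.+1 then
    (forall x, differentiable f x) /\ forall i, Ck k' (partial i f)
  else continuous f.

(* phi is in C_c^oo(Omega). *)
Definition test_function phi : Prop :=
  (forall k, Ck k phi) /\
  exists2 A, compact A & A `<=` Omega /\ forall x, ~ A x -> phi x = 0.

Definition is_weak_partial (i : 'I_d) f g : Prop :=
  L2 g /\ forall phi, test_function phi -> ip f (partial i phi) = - ip g phi.

Definition wpartial (i : 'I_d) f : sfield R d :=
  get [set g | is_weak_partial i f g].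

(* The closure of C_c^oo(Omega) in H^1(Omega); g is the weak gradient of f. *)
Definition H10 : set (sfield R d) :=
  [set f | L2 f /\ exists2 g : vfield R d, forall i, is_weak_partial i f (g i) &
    forall e, 0 < e -> exists2 phi, test_function phi &
      Num.sqrt (ip (f - phi) (f - phi) +
        \sum_i ip (g i - partial i phi) (g i - partial i phi)) < e].

(* [grad u x] i j = d_j u_i (x) *)
Definition grad u (x : 'rV[R]_d) : 'M[R]_d :=
  \matrix_(i, j) wpartial j (u i) x.

Definition bracket u v (i : 'I_d) : sfield R d := fun x =>
  \sum_j (u j x * grad v x i j - v j x * grad u x i j).

Definition form_a (w u v : vfield R d) : R :=
  - \int[mu]_(x in Omega) \sum_i (w i x * bracket u v i x).

Definition Def u x : 'M[R]_d := 2^-1 *: (grad u x + (grad u x)^T).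

Definition stress (visc lambda : R) u x : 'M[R]_d :=
  (2 * visc) *: Def u x + (lambda * \tr (grad u x))%:M.

Definition form_c (visc lambda : R) (w : sfield R d) (u v : vfield R d) : R :=
  \int[mu]_(x in Omega)
    (w x * \sum_i \sum_j (stress visc lambda u x i j * grad v x i j)).

End function_spaces.

Definition standard_simplex (R : realType) n : set 'rV[R]_n :=
  [set t | (forall i, 0 <= t 0 i) /\ \sum_i t 0 i <= 1].

Arguments standard_simplex : clear implicits.

Section simplices.
Variables (R : realType) (d nv : nat) (vtx : 'I_nv -> 'rV[R]_d).
Implicit Types A F K : {set 'I_nv}.

Definition hull A : set 'rV[R]_d :=
  [set x | exists c : 'I_nv -> R, [/\ forall i, 0 <= c i,
    \sum_(i in A) c i = 1 & x = \sum_(i in A) c i *: vtx i]].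

Definition affinely_independent A : Prop :=
  forall c : 'I_nv -> R, \sum_(i in A) c i = 0 ->
    \sum_(i in A) c i *: vtx i = 0 -> forall i, i \in A -> c i = 0.

Definition dotv (x y : 'rV[R]_d) : R := \sum_i x 0 i * y 0 i.

(* Unique when F is a facet of the nondegenerate simplex K. *)
Definition normal K F : 'rV[R]_d :=
  get [set n | [/\ dotv n n = 1,
    forall i j, i \in F -> j \in F -> dotv n (vtx i - vtx j) = 0 &
    forall i j, i \in F -> j \in K :\: F -> dotv n (vtx j - vtx i) < 0]].

(* Surface integral over the (d-1)-simplex F, through the affine
   parametrisation of F by the standard simplex of R^(d-1) and the Gram
   determinant of its edge vectors. *)
Definition face_vertex F (k : nat) : 'rV[R]_d := nth 0 [seq vtx i | i in F] k.

Definition face_edges F : 'M[R]_(d.-1, d) :=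
  \matrix_(k < d.-1) (face_vertex F k.+1 - face_vertex F 0).

Definition face_integral F (g : sfield R d) : R :=
  Num.sqrt (\det (face_edges F *m (face_edges F)^T)) *
  \int[lebesgue_rV R d.-1]_(t in standard_simplex R d.-1)
    g (face_vertex F 0 + t *m face_edges F).

End simplices.

(* Simplices are given by their sets of vertices; two closed simplices of a
   conforming triangulation meet exactly in the simplex (possibly empty)
   spanned by their common vertices. *)
Record triangulation (R : realType) (d : nat) (Omega : set 'rV[R]_d) := {
  nvertex : nat ;
  vertex : 'I_nvertex -> 'rV[R]_d ;
  ncell : nat ;
  cell : 'I_ncell -> {set 'I_nvertex} ;
  cell_inj : injective cell ;
  card_cell : forall k, #|cell k| = d.+1 ;
  cell_nondegenerate : forall k, affinely_independent vertex (cell k) ;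
  cell_conforming : forall k l,
    hull vertex (cell k) `&` hull vertex (cell l) =
    hull vertex (cell k :&: cell l) ;
  cell_interior : forall k, interior (hull vertex (cell k)) `<=` Omega ;
  cell_cover : closure Omega = \bigcup_k hull vertex (cell k)
}.

Section finite_elements.
Variables (R : realType) (d : nat) (Omega : set 'rV[R]_d).
Variable Th : triangulation Omega.
Local Notation mu := (lebesgue_rV R d).
Local Notation L2 := (L2 Omega).
Local Notation ip := (ip Omega).
Implicit Types (f g rho : sfield R d) (u v : vfield R d) (k l : 'I_(ncell Th)).

(* Fields are only meaningful in Omega; hull (cell k) lies in the closure of
   Omega and its interior in Omega, so that only a null set is removed. *)
Definition Kset k : set 'rV[R]_d := hull (@vertex _ _ _ Th) (cell k) `&` Omega.

Definition is_poly (q : nat) (p : sfield R d) : Prop :=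
  exists c : {ffun 'I_d -> 'I_q.+1} -> R, p = fun x =>
    \sum_(al : {ffun 'I_d -> 'I_q.+1} | (\sum_i al i <= q)%N)
      c al * \prod_i x 0 i ^+ al i.

Definition ae_on k f p : Prop := {ae mu, forall x, Kset k x -> f x = p x}.

Definition pw_poly (q : nat) : set (sfield R d) :=
  [set f | forall k, exists2 p, is_poly q p & ae_on k f p].

Definition Vh (q : nat) : set (sfield R d) := [set f | L2 f /\ pw_poly q f].

Definition Uh (r : nat) : set (vfield R d) :=
  [set u | forall i, H10 Omega (u i) /\ pw_poly r (u i)].

(* f|_K as a polynomial on R^d; its values on the boundary of K are the traces
   of f from K. *)
Definition restr k f : sfield R d :=
  get [set p | (exists q, is_poly q p) /\ ae_on k f p].

(* L^2-orthogonal projectors onto V_h; pi_h f is unique almost everywhere. *)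
Definition L2_projector (q : nat) (pi_h : sfield R d -> sfield R d) : Prop :=
  forall f, L2 f ->
    Vh q (pi_h f) /\ forall g, Vh q g -> ip (f - pi_h f) g = 0.

(* A face of E_h^0 is represented by the unique pair k < l of cells it
   separates. *)
Definition interior_face k l : bool :=
  [&& (k < l)%N, #|cell k :&: cell l| == d &
      `[< hull (@vertex _ _ _ Th) (cell k :&: cell l) `&` Omega !=set0 >]].

Definition jump f k l (x : 'rV[R]_d) : 'rV[R]_d :=
  let e := cell k :&: cell l in
  restr k f x *: normal (@vertex _ _ _ Th) (cell k) e +
  restr l f x *: normal (@vertex _ _ _ Th) (cell l) e.

Definition avg f k l (x : 'rV[R]_d) : R := 2^-1 * (restr k f x + restr l f x).

(* For u in U_h the traces of u from the two sides of a face agree; the trace is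
   written as their average. *)
Definition form_b f rho u : R :=
  - \sum_k \int[mu]_(x in Kset k)
      ((\sum_i u i x * partial i (restr k f) x) * rho x)
  + \sum_k \sum_(l | interior_face k l)
      face_integral (@vertex _ _ _ Th) (cell k :&: cell l)
        (fun x => dotv (\row_i avg (u i) k l x) (jump f k l x) *
                  avg rho k l x).

(* Maps on V_h are well defined on classes modulo equality almost
   everywhere. *)
Definition form_d_spec (q : nat) (D : sfield R d -> sfield R d -> sfield R d -> R) :=
  [/\ forall f f' g g' h h', Vh q f -> Vh q f' -> Vh q g -> Vh q g' ->
        Vh q h -> Vh q h' -> aeq Omega f f' -> aeq Omega g g' ->
        aeq Omega h h' -> D f g h = D f' g' h',
      forall (a : R) f f' g h, Vh q f -> Vh q f' -> Vh q g -> Vh q h ->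
        D (a *: f + f') g h = a * D f g h + D f' g h &
      forall (a : R) f g h h', Vh q f -> Vh q g -> Vh q h -> Vh q h' ->
        D f g (a *: h + h') = a * D f g h + D f g h'].

Definition form_e_spec (q : nat) (E : sfield R d -> sfield R d -> R) :=
  (forall f f' g g', Vh q f -> Vh q f' -> Vh q g -> Vh q g' ->
     aeq Omega f f' -> aeq Omega g g' -> E f g = E f' g') /\
  (forall (a : R) f f' g, Vh q f -> Vh q f' -> Vh q g ->
     E (a *: f + f') g = a * E f g + E f' g).

End finite_elements.

Section curves.
Variables (R : realType) (d : nat) (Omega : set 'rV[R]_d).

(* Derivative at t of a real function defined on I (one-sided at the end points
   of an interval). *)
Definition has_deriv_within (I : set R) (f : R -> R) (t l : R) : Prop :=
  (s - t)^-1 * (f s - f t) @[s --> within I t^'] --> l.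

(* g is the derivative at t of the curve f : I -> L^2(Omega). *)
Definition is_dt (I : set R) (f : R -> sfield R d) (t : R) (g : sfield R d) :=
  L2 Omega g /\
  L2norm Omega ((s - t)^-1 *: (f s - f t) - g) @[s --> within I t^'] --> (0 : R).

Definition dt (I : set R) (f : R -> sfield R d) (t : R) : sfield R d :=
  get [set g | is_dt I f t g].

(* The derivatives of a smooth curve with values in a finite dimensional space S
   of fields stay in S. *)
Definition smooth_curve (I : set R) (S : set (sfield R d)) (f : R -> sfield R d) :=
  exists F : nat -> R -> sfield R d, F 0%N = f /\
    forall n t, I t -> S (F n t) /\ is_dt I (F n) t (F n.+1 t).

Definition smooth_vcurve (I : set R) (S : set (vfield R d)) (u : R -> vfield R d) :=
  exists F : nat -> R -> vfield R d, F 0%N = u /\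
    forall n t, I t ->
      S (F n t) /\ forall i, is_dt I (fun s => F n s i) t (F n.+1 t i).

End curves.

Section lagrangian.
Variables (R : realType) (d : nat) (Omega : set 'rV[R]_d).

(* (u, rho, s) *)
Definition state := (vfield R d * sfield R d * sfield R d)%type.

Definition state_norm (z : state) : R :=
  Num.sqrt (vip Omega z.1.1 z.1.1 + ip Omega z.1.2 z.1.2 + ip Omega z.2 z.2).

Variables (S : set state) (D : set state).

(* D is a relatively open subset of the (linear) space S. *)
Definition open_in : Prop :=
  D `<=` S /\ forall z, D z -> exists2 e, 0 < e &
    forall h, S h -> state_norm h < e -> D (z + h).

Definition continuous_map (F : state -> sfield R d) : Prop :=
  (forall z, D z -> L2 Omega (F z)) /\
  forall z, D z -> forall e, 0 < e -> exists2 del, 0 < del &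
    forall h, S h -> state_norm h < del -> L2norm Omega (F (z + h) - F z) < e.

(* L is the Frechet derivative at z of F : D -> L^2(Omega). *)
Definition frechet (F : state -> sfield R d) (z : state) (L : state -> sfield R d) :=
  [/\ forall h, S h -> L2 Omega (L h),
      forall (a : R) h h', S h -> S h' ->
        aeq Omega (L (a *: h + h')) (a *: L h + L h'),
      exists C : R, forall h, S h -> L2norm Omega (L h) <= C * state_norm h &
      forall e, 0 < e -> exists2 del, 0 < del & forall h, S h ->
        state_norm h < del ->
        L2norm Omega (F (z + h) - F z - L h) <= e * state_norm h].

(* S is finite dimensional in the application below, so that continuity of the
   derivative may be tested in each direction h separately. *)
Fixpoint Ck_map (k : nat) (F : state -> sfield R d) : Prop :=
  continuous_map F /\
  if k is k'.+1 then
    exists2 L : state -> state -> sfield R d,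
      forall z, D z -> frechet F z (L z) &
      forall h, S h -> Ck_map k' (fun z => L z h)
  else True.

(* lu, lr, ls are the functional derivatives of ell with respect to u, rho, s at
   the states of D; X and Y are the classes of admissible variations. *)
Definition functional_derivatives (X : set (vfield R d)) (Y : set (sfield R d))
    (ell : state -> R) (lu : state -> vfield R d) (lr ls : state -> sfield R d) :=
  forall u rho s, D (u, rho, s) ->
  [/\ forall i, L2 Omega (lu (u, rho, s) i),
      L2 Omega (lr (u, rho, s)) & L2 Omega (ls (u, rho, s))] /\
  [/\ forall du, X du -> is_derive (0 : R) (1 : R)
        (fun e : R => ell (u + e *: du, rho, s)) (vip Omega (lu (u, rho, s)) du),
      forall dr, Y dr -> is_derive (0 : R) (1 : R)
        (fun e : R => ell (u, rho + e *: dr, s)) (ip Omega (lr (u, rho, s)) dr) &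
      forall ds, Y ds -> is_derive (0 : R) (1 : R)
        (fun e : R => ell (u, rho, s + e *: ds)) (ip Omega (ls (u, rho, s)) ds)].

(* Smoothness of ell on D: its functional derivatives are C^oo maps from D to
   L^2(Omega) (hence ell itself is C^oo on D). *)
Definition smooth_derivatives (lu : state -> vfield R d)
    (lr ls : state -> sfield R d) : Prop :=
  forall k, [/\ forall i, Ck_map k (fun z => lu z i), Ck_map k lr & Ck_map k ls].

End lagrangian.

Definition discrete_states (R : realType) (d : nat) (Omega : set 'rV[R]_d)
    (Th : triangulation Omega) (r q : nat) : set (state R d) :=
  (Uh Th r `*` Vh Th q) `*` Vh Th q.

(* Main.v *)
(* Testing the momentum equation with v = u (a vanishes there), the density
   equation with pi_h (dl/drho) and the entropy equation with w = 1, and moving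
   pi_h across inner products with elements of V_h, makes all terms of dE/dt
   cancel except e_h: the chain rule for ell only needs partial derivatives that
   are continuous on the open set D.  Mass is conserved because b_h (1, _, _) = 0:
   a polynomial that is 1 almost everywhere on a cell is the constant 1, so the
   volume terms vanish, and the two outer normals of an interior face are opposite
   by conformity, so the jumps vanish. *)
Require Import Defs.
From mathcomp Require Import all_boot all_order all_algebra.
From mathcomp Require Import all_classical all_reals all_analysis.
From mathcomp Require Import measurable_realfun ring lra.
Import Order.TTheory GRing.Theory Num.Theory.
Import numFieldNormedType.Exports.
Local Open Scope classical_set_scope.
Local Open Scope ring_scope.

Set Implicit Arguments.
Unset Strict Implicit.
Unset Printing Implicit Defensive.

(** * Boxes, open sets and null sets for the measure [lebesgue_rV] *)

Section lebesgue_rV_theory.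
Variable R : realType.

(** Fields are functions known only up to null sets, and [dt], [restr] and [normal] are values of
    [get]. Each of them is therefore used only after a candidate has been exhibited. Identities such
    as pi_h f = f on V_h, or the linearity of a Frechet derivative, hold almost everywhere only;
    they enter the computation through L^2 norms and inner products, through [restr], or through the
    compatibility assumed of d_h. Differentiating <dl/du, u> requires that dl/du have a derivative
    along the solution, which comes from the Frechet differentiability of [lu]. That expansion is
    available only for increments in the discrete state space, so U_h and V_h have to be proved
    linear, including the approximation by test functions in H^1_0. The product rule and the chain
    rule for ell both produce <dl/du, d_t u>; these two terms cancel, and what remains is a
    combination of the three tested equations. *)

Definition box n (c : 'rV[R]_n) (e : R) : set 'rV[R]_n :=
  [set y | forall i, `|c 0 i - y 0 i| < e].

Lemma measurable_coor_ball n (c : 'rV[R]_n) (e : R) i :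
  measurable [set y : 'rV[R]_n | `|c 0 i - y 0 i| < e].
Proof.
have := @measurable_coor _ (measurableTypeR R) n i measurableT _
  (measurable_itv `]c 0 i - e, c 0 i + e[).
rewrite setTI; congr (measurable _); apply/seteqP; split => y /=;
  rewrite in_itv /= ltr_norml; lra.
Qed.

Lemma measurable_box n (c : 'rV[R]_n) (e : R) : measurable (box c e).
Proof.
rewrite (_ : box c e = \bigcap_i [set y | `|c 0 i - y 0 i| < e]); last first.
  by apply/seteqP; split => y /= h i; [move=> _|]; exact: h.
apply: fin_bigcap_measurable => // i _; exact: measurable_coor_ball.
Qed.

Lemma lebesgue_rV_box n (c : 'rV[R]_n) (e : R) : 0 < e ->
  lebesgue_rV R n (box c e) = ((2 * e) ^+ n)%:E.
Proof.
move=> e0; elim: n c => [|n IH] c.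
  rewrite /= diracE; suff -> : (0 : 'rV[R]_0) \in box c e by [].
  by rewrite inE => -[].
rewrite /= /pushforward.
have -> : @rV_snoc R n @^-1` box c e =
    box (\row_j c 0 (lift ord_max j)) e `*`
    [set` `]c 0 ord_max - e, c 0 ord_max + e[].
  apply/seteqP; split => -[y t] /=.
    move=> h; split => [j|].
      by have := h (lift ord_max j); rewrite !mxE liftK.
    by have := h ord_max; rewrite !mxE unlift_none /= in_itv /= ltr_norml; lra.
  move=> [h1 h2] i; rewrite mxE; case: unliftP => [j ->|->] /=.
    by have := h1 j; rewrite !mxE.
  by move: h2; rewrite in_itv /= ltr_norml; lra.
rewrite product_measure1E //; last exact: measurable_box.
rewrite IH; have := @lebesgue_measure_itv R `]c 0 ord_max - e, c 0 ord_max + e[.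
rewrite /= => ->; rewrite lte_fin ifT; last lra.
by rewrite -EFinD -EFinM exprSr; congr (_ * _)%:E; lra.
Qed.

Lemma ball_box n (c : 'rV[R]_n) (e : R) : 0 < e -> ball c e = box c e.
Proof.
move=> e0; apply/seteqP; split => y h; first by move=> i; exact: (h.2 0 i).
split => //.
by move=> i j; rewrite ord1; exact: (h j).
Qed.

(** The sigma-algebra is generated by the coordinates, not by the open sets. An open set is the
    union of those boxes with rational centre and radius 1 / (m + 1) that it contains, and there are
    countably many. *)
Lemma open_rV_measurable n (A : set 'rV[R]_n) : open A -> measurable A.
Proof.
move=> oA.
pose B (p : 'rV[rat]_n * nat) : set 'rV[R]_n := box (map_mx ratr p.1) p.2.+1%:R^-1.
rewrite (_ : A = \bigcup_p (if `[< B p `<=` A >] then B p else set0)).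
  apply: countable_bigcupT_measurable => // p.
  by case: ifP => // _; exact: measurable_box.
apply/seteqP; split => [x Ax|x [p _]]; last by case: asboolP => // + Bx; apply.
have /nbhs_ballP[e /= e0 eA] : nbhs x A by exact: open_nbhs_nbhs.
(* A box of radius below [e / 2] that contains [x] lies in the ball of radius [e] about [x]. *)
have [|m me] := @ltr_add_invr R 0 (e / 2); first lra.
have [k kE] : exists k : R, k = m.+1%:R^-1 by exists m.+1%:R^-1.
have k0 : 0 < k by rewrite kE invr_gt0.
rewrite add0r -kE in me.
have /choice[p px] : forall i, exists a : rat, `|ratr a - x 0 i| < k.
  move=> i; have [|a] := @rat_in_itvoo R (x 0 i - k) (x 0 i + k); first lra.
  by rewrite in_itv /= => aP; exists a; rewrite ltr_norml; lra.
have BxP : B (\row_i p i, m) x by move=> i; rewrite !mxE -kE.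
exists (\row_i p i, m) => //; rewrite ifT //; apply/asboolP => y By.
apply: eA; rewrite ball_box// => i.
have := By i; have := BxP i; rewrite /= !mxE -kE.
move=> h1 h2; rewrite (_ : x 0 i - y 0 i = - (ratr (p i) - x 0 i) + (ratr (p i) - y 0 i)); last by ring.
by apply: le_lt_trans (ler_normD _ _) _; rewrite normrN; lra.
Qed.

Lemma bounded_box n (A : set 'rV[R]_n) : bounded_set A ->
  exists2 e, 0 < e & A `<=` box 0 e.
Proof.
move=> [M [_ /(_ (Num.max M 0 + 1))]] h.
have M0 : 0 <= Num.max M 0 by rewrite le_max lexx orbT.
have MM : M <= Num.max M 0 by rewrite le_max lexx.
have {}h := h ltac:(lra); exists (Num.max M 0 + 2); first lra.
move=> x /h hx i; rewrite mxE sub0r normrN.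
rewrite (le_lt_trans _ (_ : Num.max M 0 + 1 < _)) //; last by lra.
apply: le_trans hx; rewrite [leRHS](_ : _ = mx_norm x)// mx_normrE.
exact: (le_bigmax _ (fun ij : 'I_1 * 'I_n => `|x ij.1 ij.2|) (0, i)).
Qed.

Lemma bounded_measure_lty n (A : set 'rV[R]_n) : measurable A ->
  bounded_set A -> (lebesgue_rV R n A < +oo)%E.
Proof.
move=> mA /bounded_box[e e0 Ae]; apply: le_lt_trans (ltry ((2 * e) ^+ n)).
rewrite -(lebesgue_rV_box 0 e0); apply: le_measure => //.
  by rewrite inE.
by rewrite inE; exact: measurable_box.
Qed.

(** Boxes have positive measure, so no neighbourhood of a point of [U] fits into the exceptional
    null set. Together with continuity this turns equality almost everywhere into equality on an
    open set. *)
Lemma ae_open_dense n (U : set 'rV[R]_n) (P : set 'rV[R]_n) : open U ->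
  {ae lebesgue_rV R n, forall x, U x -> P x} -> U `<=` closure P.
Proof.
move=> oU [N [mN N0 NP]] x Ux B /nbhs_ballP[e /= e0 eB].
have /nbhs_ballP[e' /= e'0 eU] : nbhs x U by exact: open_nbhs_nbhs.
set m := Num.min e e'; have m0 : 0 < m by rewrite lt_min e0.
have : ~ (box x m `<=` N).
  move=> bN; have : (lebesgue_rV R n (box x m) <= lebesgue_rV R n N)%E.
    apply: le_measure => //; last by rewrite inE.
    by rewrite inE; exact: measurable_box.
  rewrite N0 lebesgue_rV_box // lee_fin leNgt exprn_gt0 //; lra.
move=> /nonsubset[y [by_ Ny]]; exists y.
move: by_; rewrite -ball_box// => by_.
have : ~ ~ P y.
  move=> nP; apply: Ny; apply: NP => /= h; apply: nP; apply: h.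
  by apply: eU; apply: le_ball by_; rewrite ge_min lexx orbT.
move=> /contrapT Py; split => //; apply: eB.
by apply: le_ball by_; rewrite ge_min lexx.
Qed.

End lebesgue_rV_theory.

(** * Inner product and norm of L^2(Omega) *)

Section L2_theory.
Variables (R : realType) (d : nat) (Omega : set 'rV[R]_d).
Hypothesis mO : measurable Omega.
Local Notation mu := (lebesgue_rV R d).
Local Notation L2 := (L2 Omega).
Local Notation ip := (ip Omega).
Local Notation L2norm := (L2norm Omega).
Implicit Types (f g h : sfield R d) (a : R).

Lemma L2_integrableM f g : L2 f -> L2 g ->
  mu.-integrable Omega (EFin \o (fun x => f x * g x)).
Proof.
move=> [mf f2] [mg g2].
apply: (@le_integrable _ _ _ _ _ mO _ (fun x => (f x ^+ 2)%:E + (g x ^+ 2)%:E)%E).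
- exact/measurable_EFinP/measurable_funM.
- move=> x _; rewrite /= lee_fin [leRHS]ger0_norm ?addr_ge0 ?sqr_ge0//.
  by rewrite ler_norml; apply/andP; split; nra.
- exact: integrableD.
Qed.

Lemma L2D f g : L2 f -> L2 g -> L2 (f + g).
Proof.
move=> Lf Lg; split; first exact: measurable_funD Lf.1 Lg.1.
apply: (eq_integrable mO (fun x => ((f x ^+ 2)%:E + (g x ^+ 2)%:E) +
    ((f x * g x)%:E + (f x * g x)%:E))%E).
  by move=> x _; rewrite /= -!EFinD; congr EFin; rewrite !fctE; ring.
have h := L2_integrableM Lf Lg.
by apply: integrableD => //; apply: integrableD => //; [exact: Lf.2|exact: Lg.2].
Qed.

Lemma L2Z a f : L2 f -> L2 (a *: f).
Proof.
move=> Lf; split.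
  by apply: measurable_funM; [exact: measurable_cst|exact: Lf.1].
apply: (eq_integrable mO (fun x => (a ^+ 2)%:E * (f x ^+ 2)%:E)%E).
  by move=> x _; rewrite /= -EFinM; congr EFin; rewrite !fctE /GRing.scale /=; ring.
exact: integrableZl Lf.2.
Qed.

Lemma L2N f : L2 f -> L2 (- f).
Proof. by rewrite -scaleN1r; exact: L2Z. Qed.

Lemma L2B f g : L2 f -> L2 g -> L2 (f - g).
Proof. by move=> Lf Lg; apply: L2D => //; exact: L2N. Qed.

Lemma ipC f g : ip f g = ip g f.
Proof. by rewrite /ip; under eq_Rintegral do rewrite mulrC. Qed.

Lemma ipDl f g h : L2 f -> L2 g -> L2 h -> ip (f + g) h = ip f h + ip g h.
Proof.
move=> Lf Lg Lh; rewrite /ip -RintegralD//; try exact: L2_integrableM.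
by apply: eq_Rintegral => x _; rewrite !fctE mulrDl.
Qed.

Lemma ipZl a f g : L2 f -> L2 g -> ip (a *: f) g = a * ip f g.
Proof.
move=> Lf Lg; rewrite /ip -RintegralZl//; try exact: L2_integrableM.
by apply: eq_Rintegral => x _; rewrite !fctE /GRing.scale /= mulrA.
Qed.

Lemma ipNl f g : L2 f -> L2 g -> ip (- f) g = - ip f g.
Proof. by move=> *; rewrite -scaleN1r ipZl// mulN1r. Qed.

Lemma ipBl f g h : L2 f -> L2 g -> L2 h -> ip (f - g) h = ip f h - ip g h.
Proof. by move=> *; rewrite ipDl ?ipNl//; exact: L2N. Qed.

Lemma ipDr f g h : L2 f -> L2 g -> L2 h -> ip h (f + g) = ip h f + ip h g.
Proof. by move=> *; rewrite ipC ipDl// ![ip h _]ipC. Qed.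

Lemma ipZr a f g : L2 f -> L2 g -> ip g (a *: f) = a * ip g f.
Proof. by move=> *; rewrite ipC ipZl// ipC. Qed.

Lemma ipBr f g h : L2 f -> L2 g -> L2 h -> ip h (f - g) = ip h f - ip h g.
Proof. by move=> *; rewrite ipC ipBl// ![ip h _]ipC. Qed.

Lemma ip_ge0 f : 0 <= ip f f.
Proof. by apply: Rintegral_ge0 => x _; rewrite -expr2 sqr_ge0. Qed.

Lemma ip_sqrD f g : L2 f -> L2 g ->
  ip (f + g) (f + g) = ip f f + 2 * ip f g + ip g g.
Proof.
move=> Lf Lg; have Lfg := L2D Lf Lg.
by rewrite ipDl// !ipDr// (ipC g f); ring.
Qed.

Lemma ip_sqrD_le f g : L2 f -> L2 g ->
  ip (f + g) (f + g) <= 2 * ip f f + 2 * ip g g.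
Proof.
move=> Lf Lg; have := ip_ge0 (f - g); have Lg' := L2N Lg.
rewrite ip_sqrD// ip_sqrD// ipC ipNl// ipNl// [ip g (- g)]ipC ipNl//.
rewrite (ipC g f); lra.
Qed.

Lemma ip_sqrZ a f : L2 f -> ip (a *: f) (a *: f) = a ^+ 2 * ip f f.
Proof. by move=> Lf; have := L2Z a Lf => ?; rewrite ipZl// ipZr//; ring. Qed.

Lemma L2norm_ge0 f : 0 <= L2norm f. Proof. exact: sqrtr_ge0. Qed.

Lemma sqr_L2norm f : L2norm f ^+ 2 = ip f f.
Proof. by rewrite /L2norm sqr_sqrtr// ip_ge0. Qed.

Lemma ip_CS f g : L2 f -> L2 g -> `|ip f g| <= L2norm f * L2norm g.
Proof.
move=> Lf Lg; rewrite -(@ler_pXn2r _ 2)// ?nnegrE ?mulr_ge0 ?L2norm_ge0//.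
rewrite exprMn !sqr_L2norm real_normK ?num_real//.
set A := ip f f; set B := ip f g; set C := ip g g.
(* The squared norm of [f + a *: g] is a nonnegative quadratic in [a]. If [C] is 0 it is affine in
   [a] and would take the value -1 for nonzero [B]; otherwise the minimiser [- B / C] gives the
   bound. *)
have P a : 0 <= A + 2 * a * B + a ^+ 2 * C.
  have := ip_ge0 (f + a *: g); have La := L2Z a Lg.
  by rewrite ip_sqrD// ipZr// ip_sqrZ// mulrA.
have C0 : 0 <= C by exact: ip_ge0.
have [C_eq0|Cn0] := eqVneq C 0.
  rewrite C_eq0 mulr0; have [->|Bn0] := eqVneq B 0; first by rewrite expr0n.
  have := P (- (A + 1) / (2 * B)); rewrite C_eq0.
  rewrite (_ : A + _ + _ = -1); last first.
    by move: Bn0; clearbody B A => Bn0; field.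
  by rewrite oppr_ge0 ler10.
have := P (- B / C).
have -> : A + 2 * (- B / C) * B + (- B / C) ^+ 2 * C = A - B ^+ 2 / C by field.
by rewrite subr_ge0 ler_pdivrMr// lt_neqAle eq_sym Cn0.
Qed.

Lemma L2norm_triangle f g : L2 f -> L2 g -> L2norm (f + g) <= L2norm f + L2norm g.
Proof.
move=> Lf Lg; rewrite -(@ler_pXn2r _ 2)// ?nnegrE ?addr_ge0 ?L2norm_ge0//.
rewrite sqrrD !sqr_L2norm ip_sqrD//.
by have := ler_norm (ip f g); have := ip_CS Lf Lg; lra.
Qed.

Lemma L2normZ a f : L2 f -> L2norm (a *: f) = `|a| * L2norm f.
Proof.
by move=> Lf; rewrite /L2norm ip_sqrZ// sqrtrM ?sqr_ge0// sqrtr_sqr.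
Qed.

Lemma L2normN f : L2 f -> L2norm (- f) = L2norm f.
Proof. by move=> Lf; rewrite -scaleN1r L2normZ// normrN1 mul1r. Qed.

Lemma ip_eq0_aeq0 f : L2 f -> ip f f = 0 -> aeq Omega f 0.
Proof.
move=> Lf; rewrite /ip /Rintegral => I0.
have : (\int[mu]_(x in Omega) `|(f x * f x)%:E|)%E = 0%E.
  have /fineK finE := integrable_fin_num mO (L2_integrableM Lf Lf).
  rewrite -[RHS]/(EFin 0) -I0 [RHS]finE.
  by apply: eq_integral => x _; rewrite /= ger0_norm// -expr2 sqr_ge0.
have mff : measurable_fun Omega (EFin \o (fun x => f x * f x)).
  by apply: (measurable_int mu); exact: L2_integrableM.
move/(ae_eq_integral_abs _ mO mff) => [N [mN N0 sN]].
exists N; split => //; apply: subset_trans sN.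
apply: subsetC => x /= h Ox; have [] := h Ox.
by move=> /eqP; rewrite mulf_eq0 orbb => /eqP.
Qed.

Lemma ip_aeq f f' g : L2 f -> L2 f' -> L2 g -> L2norm (f - f') = 0 -> ip f g = ip f' g.
Proof.
move=> Lf Lf' Lg n0; apply/eqP; rewrite -subr_eq0 -ipBl// -normr_le0.
by apply: le_trans (ip_CS (L2B Lf Lf') Lg) _; rewrite n0 mul0r.
Qed.

Lemma aeq_L2norm0 f g : L2 f -> L2 g -> aeq Omega f g -> L2norm (f - g) = 0.
Proof.
move=> Lf Lg [N [mN N0 sN]].
suff h : ip (f - g) (f - g) = 0 by rewrite /L2norm h sqrtr0.
have m1 : measurable_fun Omega (EFin \o (fun x => (f - g) x * (f - g) x)).
  by apply: (measurable_int mu); apply: L2_integrableM; exact: L2B.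
rewrite /ip /Rintegral (ae_eq_integral (cst 0%E) _ mO m1) ?integral0//.
exists N; split => //; apply: subset_trans sN; apply: subsetC => x /= h Ox.
by rewrite !fctE h// subrr mulr0.
Qed.

Lemma bounded_L2 f (C : R) : (mu Omega < +oo)%E -> measurable_fun Omega f ->
  (forall x, Omega x -> `|f x| <= C) -> L2 f.
Proof.
move=> muO mf fC; split => //.
apply: (@le_integrable _ _ _ _ _ mO _ (cst (C ^+ 2)%:E)).
- exact/measurable_EFinP/measurable_funX.
- move=> x Ox /=; rewrite lee_fin !normrX lerXn2r ?nnegrE//.
  by apply: le_trans (fC _ Ox) (ler_norm _).
- apply/integrableP; split; first exact: measurable_cst.
  by rewrite /= integral_cst// lte_mul_pinfty.
Qed.

End L2_theory.

(** Numerical part of [H10_linear]: the two tolerances contribute at most (e/2)^2 each, and the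
    factors 2 add this up to e^2. Dividing by [|a| + 1] instead of [|a|] covers a = 0. *)
Lemma sqrtr_lt_sum (R : realType) (a e S1 S2 T : R) : 0 < e -> 0 <= S1 -> 0 <= S2 ->
  Num.sqrt S1 < e / 2 / (`|a| + 1) -> Num.sqrt S2 < e / 2 ->
  T <= 2 * a ^+ 2 * S1 + 2 * S2 -> Num.sqrt T < e.
Proof.
move=> e0 S10 S20 S1e S2e TS.
have a1 : 0 < `|a| + 1 by rewrite ltr_wpDl.
have S1q : S1 * (`|a| + 1) ^+ 2 < (e / 2) ^+ 2.
  rewrite -(sqr_sqrtr S10) -exprMn ltr_pXn2r// ?nnegrE.
  - by rewrite -ltr_pdivlMr.
  - by rewrite mulr_ge0 ?sqrtr_ge0 ?ltW.
  - by rewrite divr_ge0// ltW.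
have S2q : S2 < (e / 2) ^+ 2.
  by rewrite -(sqr_sqrtr S20) ltr_pXn2r// ?nnegrE ?sqrtr_ge0 ?divr_ge0 ?ltW.
have aS : a ^+ 2 * S1 <= S1 * (`|a| + 1) ^+ 2.
  rewrite mulrC ler_wpM2l// -(real_normK (num_real a)).
  by rewrite ler_pXn2r ?nnegrE ?lerDl// ltW.
have Te : T < e ^+ 2.
  by move: S1q S2q; rewrite expr_div_n; lra.
rewrite -(ger0_norm (ltW e0)) -sqrtr_sqr ltr_sqrt//.
by rewrite exprn_gt0.
Qed.

(** * Linearity of V_h and U_h *)

Section linear_spaces.
Variables (R : realType) (d : nat) (Omega : set 'rV[R]_d).
Hypotheses (Omega_open : open Omega) (Omega_bounded : bounded_set Omega).
Local Notation mu := (lebesgue_rV R d).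
Local Notation L2 := (L2 Omega).
Local Notation ip := (ip Omega).
Implicit Types (f g : sfield R d) (u v : vfield R d) (a : R).

Let mO : measurable Omega := open_rV_measurable Omega_open.
Let muO : (mu Omega < +oo)%E := bounded_measure_lty mO Omega_bounded.

Lemma continuous_rV_measurable f : continuous f -> measurable_fun setT f.
Proof.
move=> /continuousP cf; apply: (measurability _ (RGenOpens.measurableE R)) => //.
move=> _ [_ [a [b ->] <-]]; rewrite setTI.
by apply: open_rV_measurable; apply: cf; exact: interval_open.
Qed.

(** Continuity on all of R^d bounds [f] on a compact cube around the bounded set [Omega], whose
    measure is finite. *)
Lemma continuous_L2 f : continuous f -> L2 f.
Proof.
move=> cf.
have [e e0 Oe] := bounded_box Omega_bounded.
pose K : set 'rV[R]_d := [set v | forall i, `[- e, e]%classic (v 0 i)].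
have OK : Omega `<=` K.
  move=> x /Oe xe i /=; rewrite in_itv /= -ler_norml ltW//.
  by have := xe i; rewrite mxE sub0r normrN.
have cK : compact K by apply: (rV_compact (fun i => @segment_compact R (- e) e)).
have /compact_bounded[M [Mr MO]] : compact (f @` K).
  by apply: continuous_compact => //; exact: continuous_subspaceT.
apply: (@bounded_L2 _ _ _ mO _ (M + 1)) => //.
  by apply: (measurable_funS measurableT) => //; exact: continuous_rV_measurable.
move=> x Ox; apply: (MO (M + 1)); first by rewrite ltrDl.
by exists x => //; exact: OK.
Qed.

Lemma partial_linear i a f g : (forall x, differentiable f x) ->
  (forall x, differentiable g x) ->
  partial i (a *: f + g) = a *: partial i f + partial i g.
Proof.
move=> df dg; apply/funext => x; rewrite /partial.
have Df : derivable f x (delta_mx 0 i) by exact: diff_derivable.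
have Dg : derivable g x (delta_mx 0 i) by exact: diff_derivable.
by rewrite (deriveD (derivableZ Df) Dg) (deriveZ a Df).
Qed.

Lemma Ck_linear k a f g : Ck k f -> Ck k g -> Ck k (a *: f + g).
Proof.
elim: k f g => [|k IH] f g /=.
  move=> cf cg x; apply: continuousD; last exact: cg.
  by apply: continuousZr; exact: cf.
move=> [df Cf] [dg Cg]; split=> [x|i].
  by apply: differentiableD => //; exact: differentiableZ.
by rewrite partial_linear//; exact: IH.
Qed.

Lemma test_function_linear a f g : test_function Omega f ->
  test_function Omega g -> test_function Omega (a *: f + g).
Proof.
move=> [Cf [A cA [AO A0]]] [Cg [B cB [BO B0]]].
split=> [k|]; first exact: Ck_linear.
exists (A `|` B); first exact: compactU.
split=> [x [/AO|/BO]//|x /not_orP[nA nB]].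
by rewrite !fctE A0// B0// scaler0 addr0.
Qed.

Lemma test_function_L2 f : test_function Omega f -> L2 f.
Proof. by move=> [/(_ 0%N) cf _]; exact: continuous_L2. Qed.

Lemma test_function_partial_L2 i f : test_function Omega f -> L2 (partial i f).
Proof. by move=> [/(_ 1%N)[_ /(_ i) cf] _]; exact: continuous_L2. Qed.

Lemma test_function_differentiable f x :
  test_function Omega f -> differentiable f x.
Proof. by move=> [/(_ 1%N)[]]. Qed.

Lemma L2_linear a f g : L2 f -> L2 g -> L2 (a *: f + g).
Proof. by move=> Lf Lg; apply: L2D => //; exact: L2Z. Qed.

Lemma is_weak_partial_linear i a f f' g g' : L2 f -> L2 g ->
  is_weak_partial Omega i f f' -> is_weak_partial Omega i g g' ->
  is_weak_partial Omega i (a *: f + g) (a *: f' + g').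
Proof.
move=> Lf Lg [Lf' ff'] [Lg' gg']; split=> [|phi tphi]; first exact: L2_linear.
have Lphi := test_function_L2 tphi; have Lp := test_function_partial_L2 i tphi.
have Laf := L2Z mO a Lf; have Laf' := L2Z mO a Lf'.
by rewrite !ipDl// !ipZl// ff'// gg'//; ring.
Qed.

(** Keeps difference quotients of velocity curves in U_h. Approximating test functions combine
    linearly, and the squared H^1 distance of the combination is at most
    [2 * a ^+ 2 * S1 + 2 * S2]. *)
Lemma H10_linear a f g : H10 Omega f -> H10 Omega g -> H10 Omega (a *: f + g).
Proof.
move=> [Lf [f' wf hf]] [Lg [g' wg hg]]; split; first exact: L2_linear.
exists (fun i => a *: f' i + g' i).
  by move=> i; apply: is_weak_partial_linear.
move=> e e0.
have e1 : 0 < e / 2 / (`|a| + 1) by rewrite !divr_gt0// ltr_wpDl.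
have [phi tphi phie] := hf _ e1.
have [psi tpsi psie] := hg (e / 2) ltac:(lra).
exists (a *: phi + psi); first exact: test_function_linear.
have ip0 h : 0 <= ip h h by exact: ip_ge0.
set S1 := ip (f - phi) _ + _ in phie; set S2 := ip (g - psi) _ + _ in psie.
have lin h h' p p' : L2 h -> L2 h' -> L2 p -> L2 p' ->
  ip (a *: h + h' - (a *: p + p')) (a *: h + h' - (a *: p + p')) <=
  2 * a ^+ 2 * ip (h - p) (h - p) + 2 * ip (h' - p') (h' - p').
  move=> Lh Lh' Lp Lp'.
  have -> : a *: h + h' - (a *: p + p') = a *: (h - p) + (h' - p').
    by rewrite scalerBr opprD addrACA.
  have L1 : L2 (h - p) by exact: L2B.
  have L1' : L2 (h' - p') by exact: L2B.
  by rewrite -mulrA -(ip_sqrZ mO)//; apply: ip_sqrD_le => //; exact: L2Z.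
apply: (sqrtr_lt_sum e0 _ _ phie psie); rewrite ?addr_ge0 ?sumr_ge0//.
rewrite /S1 /S2 !mulrDr addrACA lerD//.
  by apply: lin => //; exact: test_function_L2.
rewrite !mulr_sumr -big_split/= ler_sum// => i _.
have dphi x := test_function_differentiable x tphi.
have dpsi x := test_function_differentiable x tpsi.
rewrite partial_linear//; apply: lin; [exact: (wf i).1|exact: (wg i).1| |];
  exact: test_function_partial_L2.
Qed.

Lemma is_poly_linear q a f g : is_poly q f -> is_poly q g -> is_poly q (a *: f + g).
Proof.
move=> [c ->] [c' ->]; exists (fun al => a * c al + c' al); apply/funext => x.
rewrite !fctE /GRing.scale /= mulr_sumr -big_split; apply: eq_bigr => al _ /=.
by rewrite mulrDl mulrA.
Qed.

Variable Th : triangulation Omega.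

Lemma pw_poly_linear q a f g : pw_poly Th q f -> pw_poly Th q g ->
  pw_poly Th q (a *: f + g).
Proof.
move=> hf hg k; have [p pp fp] := hf k; have [p' pp' gp] := hg k.
exists (a *: p + p'); first exact: is_poly_linear.
by apply: filterS2 fp gp => x h h' Kx; rewrite !fctE h// h'.
Qed.

Lemma Vh_linear q a f g : Vh Th q f -> Vh Th q g -> Vh Th q (a *: f + g).
Proof.
by move=> [Lf pf] [Lg pg]; split; [exact: L2_linear|exact: pw_poly_linear].
Qed.

Lemma Uh_linear r a u v : Uh Th r u -> Uh Th r v -> Uh Th r (a *: u + v).
Proof.
move=> hu hv i; have [Hu pu] := hu i; have [Hv pv] := hv i.
by split; [exact: H10_linear|exact: pw_poly_linear].
Qed.

Lemma VhB q f g : Vh Th q f -> Vh Th q g -> Vh Th q (f - g).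
Proof. by move=> hf hg; rewrite addrC -scaleN1r; exact: Vh_linear. Qed.

Lemma VhN q f : Vh Th q f -> Vh Th q (- f).
Proof.
move=> hf; have h0 : Vh Th q (0 : sfield R d) by rewrite -(subrr f); exact: VhB.
by rewrite -scaleN1r -[_ *: _]addr0; exact: Vh_linear.
Qed.

Lemma Vh_cst1 q : Vh Th q (cst 1).
Proof.
split; first by apply: continuous_L2; exact: cst_continuous.
move=> k; exists (cst 1); last by exists set0; split => // x /= /not_implyP[].
exists (fun al => (al == [ffun=> ord0])%:R); apply/funext => x.
rewrite (bigD1 [ffun=> ord0])/=; last by rewrite big1// => i _; rewrite ffunE.
rewrite [X in _ + X]big1 => [|al /andP[_ /negPf ->]]; last by rewrite mul0r.
by rewrite eqxx mul1r addr0 big1// => i _; rewrite ffunE expr0.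
Qed.

End linear_spaces.

(** * Barycentric coordinates of a nondegenerate simplex *)

Section barycentric_coordinates.
Variables (R : realType) (d nv : nat) (vtx : 'I_nv -> 'rV[R]_d).
Implicit Types (A F K L : {set 'I_nv}) (x y n : 'rV[R]_d).

Lemma dotvDr x y n : dotv n (x + y) = dotv n x + dotv n y.
Proof. by rewrite /dotv -big_split; apply: eq_bigr => i _; rewrite mxE mulrDr. Qed.

Lemma dotvZr a x n : dotv n (a *: x) = a * dotv n x.
Proof. by rewrite /dotv mulr_sumr; apply: eq_bigr => i _; rewrite mxE mulrCA. Qed.

Lemma dotvC x y : dotv x y = dotv y x.
Proof. by apply: eq_bigr => i _; rewrite mulrC. Qed.

Lemma dotvZl a x n : dotv (a *: n) x = a * dotv n x.
Proof. by rewrite dotvC dotvZr dotvC. Qed.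

Lemma dotvBr x y n : dotv n (x - y) = dotv n x - dotv n y.
Proof. by rewrite -scaleN1r dotvDr dotvZr mulN1r. Qed.

Lemma dotv0r n : dotv n 0 = 0.
Proof. by rewrite -(scale0r 0) dotvZr mul0r. Qed.

Lemma dotv_sumr A n (c : 'I_nv -> R) (w : 'I_nv -> 'rV[R]_d) :
  dotv n (\sum_(i in A) c i *: w i) = \sum_(i in A) c i * dotv n (w i).
Proof.
rewrite (big_morph (dotv n) (fun x y => dotvDr x y n) (dotv0r n)).
by apply: eq_bigr => i _; rewrite dotvZr.
Qed.

Lemma dotv_eq0 x : (dotv x x == 0) = (x == 0).
Proof.
apply/eqP/eqP => [|->]; last exact: dotv0r.
move=> /eqP; rewrite psumr_eq0 => [|i _]; last by rewrite -expr2 sqr_ge0.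
move=> /allP h; apply/rowP => i; rewrite mxE; apply/eqP.
by have := h i (mem_index_enum _); rewrite -expr2 sqrf_eq0.
Qed.

Lemma dotv_ge0 x : 0 <= dotv x x.
Proof. by apply: sumr_ge0 => i _; rewrite -expr2 sqr_ge0. Qed.

Lemma dotv_continuous n : continuous (dotv n).
Proof.
apply: continuous_big => [|i _ x]; first exact: add_continuous.
by apply: continuousM; [exact: cst_continuous|exact: coord_continuous].
Qed.

(** Affine independence makes the rows (vertex, 1) of [M] independent, so [M] is invertible because
    [A] has d + 1 elements. The coordinates of [x] are the row (x, 1) times the inverse; they are
    affine in [x], with gradient [g i] and constant term [b i] read off the columns. *)
Lemma barycentric A : affinely_independent vtx A -> #|A| = d.+1 ->
  exists (g : 'I_nv -> 'rV[R]_d) (b : 'I_nv -> R),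
  [/\ forall x, \sum_(i in A) (dotv (g i) x + b i) = 1,
      forall x, \sum_(i in A) (dotv (g i) x + b i) *: vtx i = x &
      forall i j, i \in A -> j \in A -> dotv (g i) (vtx j) + b i = (i == j)%:R].
Proof.
move=> aiA cA.
pose M : 'M[R]_(#|A|, d + 1) :=
  \matrix_(a < #|A|) row_mx (vtx (enum_val a)) (const_mx 1).
have mulM (u : 'rV_#|A|) : u *m M = row_mx
    (\sum_a u 0 a *: vtx (enum_val a)) (const_mx (\sum_a u 0 a)).
  rewrite mulmx_sum_row; under eq_bigr do rewrite rowK scale_row_mx.
  apply/rowP => j; rewrite summxE; case: (split_ordP j) => k ->.
    by rewrite row_mxEl summxE; apply: eq_bigr => a _; rewrite row_mxEl.
  rewrite row_mxEr mxE; apply: eq_bigr => a _.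
  by rewrite row_mxEr !mxE mulr1.
have Mfree : row_free M.
  rewrite -kermx_eq0; apply/rowV0P => u /sub_kermxP; rewrite mulM.
  rewrite -[X in _ = X -> _]row_mx0 => /eq_row_mx[u0 /rowP/(_ 0)]; rewrite !mxE => u1.
  (* Extends [u], indexed by positions in the enumeration of [A], by zero to all vertices, the form
     that [affinely_independent] expects. *)
  pose c i := \sum_a (enum_val a == i)%:R * u 0 a.
  have cE a : c (enum_val a) = u 0 a.
    rewrite /c (bigD1 a)//= eqxx mul1r big1 ?addr0// => a' a'a.
    by rewrite (inj_eq enum_val_inj) (negPf a'a) mul0r.
  apply/rowP => a; rewrite mxE -cE; apply: aiA (enum_valP a).
    by rewrite big_enum_val/=; under eq_bigr do rewrite cE.
  by rewrite big_enum_val/=; under eq_bigr do rewrite cE.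
have Mfull : row_full M by rewrite /row_full (eqP Mfree) cA addn1.
(* The second factor re-indexes the columns by vertices, with zero columns outside [A]. *)
pose P := pinvmx M *m \matrix_(a < #|A|, i < nv) (enum_val a == i)%:R.
pose g i : 'rV_d := \row_j P (lshift 1 j) i.
pose b i : R := P (rshift d 0) i.
have gbE x i : dotv (g i) x + b i = (row_mx x (const_mx 1 : 'rV_1) *m P) 0 i.
  rewrite mxE big_split_ord/= big_ord1 row_mxEr mxE mul1r; congr (_ + _).
  by apply: eq_bigr => j _; rewrite row_mxEl mxE mulrC.
have gbM x : let u := row_mx x (const_mx 1 : 'rV_1) *m pinvmx M in
    (forall a, dotv (g (enum_val a)) x + b (enum_val a) = u 0 a) /\
    u *m M = row_mx x (const_mx 1).
  split; last by rewrite mulmxKpV//; exact: submx_full.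
  move=> a; rewrite gbE mulmxA mxE (bigD1 a)//= mxE eqxx mulr1 big1 ?addr0//.
  by move=> a' a'a; rewrite mxE (inj_eq enum_val_inj) (negPf a'a) mulr0.
have h1 x : \sum_(i in A) (dotv (g i) x + b i) = 1.
  have [uE] := gbM x; rewrite mulM => /eq_row_mx[_ /rowP/(_ 0)]; rewrite !mxE => <-.
  by rewrite big_enum_val/=; apply: eq_bigr => a _; exact: uE.
have h2 x : \sum_(i in A) (dotv (g i) x + b i) *: vtx i = x.
  have [uE] := gbM x; rewrite mulM => /eq_row_mx[+ _].
  move=> uM; rewrite -[RHS]uM big_enum_val/=; apply: eq_bigr => a _; congr (_ *: _).
  exact: uE.
exists g, b; split => // i j iA jA; apply/eqP; rewrite -subr_eq0; apply/eqP.
(* The coordinates of [vtx j] and the Kronecker family represent the same point, so their difference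
   is an affine relation among the vertices. *)
apply: (aiA (fun i => dotv (g i) (vtx j) + b i - (i == j)%:R)) => //.
  rewrite big_split/= h1 sumrN (bigD1 j)//= eqxx big1 ?addr0 ?subrr//.
  by move=> k /andP[_ /negPf ->].
under eq_bigr do rewrite scalerBl.
rewrite big_split/= h2 sumrN (bigD1 j)//= eqxx scale1r big1 ?addr0 ?subrr//.
by move=> k /andP[_ /negPf ->]; rewrite scale0r.
Qed.

(** All barycentric coordinates of the centroid equal 1 / (d + 1). By continuity they stay positive
    nearby, where they serve as coefficients for [hull]. *)
Lemma interior_hull_nonempty A : affinely_independent vtx A -> #|A| = d.+1 ->
  interior (hull vtx A) !=set0.
Proof.
move=> aiA cA; have [g [b [h1 h2 h3]]] := barycentric aiA cA.
pose w : R := d.+1%:R^-1; have w0 : 0 < w by rewrite invr_gt0.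
pose x := \sum_(i in A) w *: vtx i.
have sumw : \sum_(i in A) w = 1.
  by rewrite sumr_const cA -mulr_natr mulVf// pnatr_eq0.
have xE i : i \in A -> dotv (g i) x + b i = w.
  move=> iA; rewrite dotv_sumr -[b i]mul1r -sumw mulr_suml -big_split/=.
  rewrite (eq_bigr (fun j => w * (i == j)%:R)) => [|j jA]; last first.
    by rewrite -mulrDr h3.
  rewrite (bigD1 i)//= eqxx mulr1 big1 ?addr0// => j /andP[_ /negPf ji].
  by rewrite eq_sym ji mulr0.
exists x; rewrite /interior /=.
have : \forall y \near x, forall i, i \in A -> 0 < dotv (g i) y + b i.
  apply: (@filter_forall _ _ (fun i y => i \in A -> 0 < dotv (g i) y + b i) _ (nbhs_filter x)) => i.
  case: (boolP (i \in A)) => iA; last by apply: nearW.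
  have ci : (fun y => dotv (g i) y + b i) @ x --> dotv (g i) x + b i.
    exact: (cvgD (@dotv_continuous (g i) x) (cvg_cst (b i))).
  rewrite xE// in ci.
  by apply: filterS (cvgr_gt _ ci _ w0).
apply: filterS => y yp.
exists (fun i => if i \in A then dotv (g i) y + b i else 0); split.
- by move=> i; case: ifPn => // iA; rewrite ltW// yp.
- by rewrite -[RHS](h1 y); apply: eq_bigr => i ->.
- by rewrite -[LHS](h2 y); apply: eq_bigr => i ->.
Qed.

End barycentric_coordinates.

(** * Outer unit normals of a face shared by two simplices *)

Section normals.
Variables (R : realType) (d nv : nat) (vtx : 'I_nv -> 'rV[R]_d).
Implicit Types (A F K L : {set 'I_nv}) (x y n : 'rV[R]_d).

(** The predicate from which [get] selects in [normal]. *)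
Definition outer_normal K F n : Prop :=
  [/\ dotv n n = 1,
    forall i j, i \in F -> j \in F -> dotv n (vtx i - vtx j) = 0 &
    forall i j, i \in F -> j \in K :\: F -> dotv n (vtx j - vtx i) < 0].

(** The barycentric coordinate of the vertex opposite to [F] is constant on the vertices of [F] and
    larger at that vertex, so its normalised negative gradient is a candidate. A vertex of [F],
    available since [0 < d], shows that this gradient is nonzero. *)
Lemma normalP K F : (0 < d)%N -> affinely_independent vtx K ->
  #|K| = d.+1 -> F \subset K -> #|F| = d -> outer_normal K F (normal vtx K F).
Proof.
move=> d0 aiK cK FK cF; apply: (@getPex _ (outer_normal K F)).
have [g [b [_ _ h]]] := barycentric aiK cK.
have /eqP/cards1P[j KFj] : #|K :\: F| = 1%N.
  by rewrite cardsD (finset.setIidPr FK) cK cF subSnn.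
have /finset.setDP[jK jF] : j \in K :\: F by rewrite KFj set11.
have [i0 i0F] : exists i, i \in F by apply/set0Pn; rewrite -card_gt0 cF.
have gi i : i \in F -> dotv (g j) (vtx i) = - b j.
  move=> iF; have := h j i jK (fintype.subsetP FK _ iF).
  have -> : (j == i) = false by apply: contraNF jF => /eqP ->.
  by move=> /eqP; rewrite addr_eq0 => /eqP.
have gj i : i \in F -> dotv (g j) (vtx j - vtx i) = 1.
  move=> iF; rewrite dotvBr (gi i iF) opprK.
  by have := h j j jK jK; rewrite eqxx.
have gg : 0 < dotv (g j) (g j).
  rewrite lt_neqAle dotv_ge0 andbT eq_sym dotv_eq0; apply/eqP => g0.
  by have := gj _ i0F; rewrite g0 dotvC dotv0r => /eqP; rewrite eq_sym oner_eq0.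
set s := Num.sqrt (dotv (g j) (g j)).
have s0 : 0 < s by rewrite sqrtr_gt0.
exists (- s^-1 *: g j); split.
- rewrite dotvZl dotvZr mulrA mulrNN -expr2 exprVn sqr_sqrtr ?ltW//.
  by rewrite mulVf// gt_eqF.
- by move=> i k iF kF; rewrite dotvZl dotvBr (gi i iF) (gi k kF) subrr mulr0.
- move=> i k iF; rewrite KFj inE => /eqP ->; rewrite dotvZl gj// mulr1.
  by rewrite oppr_lt0 invr_gt0.
Qed.

(** Relative to [vtx i0], all vertices of [F] contribute zero. The coefficients may have any sign,
    so this applies to every point of the space. *)
Lemma dotv_barycentric j F n i0 (c : 'I_nv -> R) x : j \notin F -> i0 \in F ->
  (forall i, i \in F -> dotv n (vtx i - vtx i0) = 0) ->
  \sum_(i in j |: F) c i = 1 -> \sum_(i in j |: F) c i *: vtx i = x ->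
  dotv n (x - vtx i0) = c j * dotv n (vtx j - vtx i0).
Proof.
move=> jF i0F nF c1 <-.
rewrite -[vtx i0 in LHS]scale1r -c1 scaler_suml -sumrB.
under eq_bigr do rewrite -scalerBr.
rewrite dotv_sumr big_setU1//= big1 ?addr0// => i iF.
by rewrite nF// mulr0.
Qed.

(* Otherwise a point of the first cell close to the centroid of the common
   face would also belong to the second cell. *)
Lemma barycentric_opposite_le0 F j m i0 n (mu : 'I_nv -> R) :
  j \notin F -> m \notin F -> i0 \in F ->
  (forall i, i \in F -> dotv n (vtx i - vtx i0) = 0) ->
  dotv n (vtx j - vtx i0) != 0 ->
  hull vtx (j |: F) `&` hull vtx (m |: F) `<=` hull vtx F ->
  \sum_(i in m |: F) mu i = 1 -> \sum_(i in m |: F) mu i *: vtx i = vtx j ->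
  mu m <= 0.
Proof.
move=> jF mF i0F nF nj sub mu1 muj; rewrite leNgt; apply/negP => mum.
have F0 : (0 < #|F|)%N by rewrite card_gt0; apply/set0Pn; exists i0.
pose S : R := \sum_(i in F) `|mu i|.
have S0 : 0 <= S by exact: sumr_ge0.
have [D DE] : exists D : R, D = #|F|%:R by exists #|F|%:R.
have D0 : 0 < D by rewrite DE ltr0n.
(* The point [x] below has coefficient [e] at [vtx j] and [e * S] at each vertex of [F]; this [e]
   makes the sum 1. Expanding [vtx j] by [mu] turns the coefficients into [e * mu m] and
   [e * S + e * mu i], nonnegative since [S] dominates each |mu i|, so [x] lies in both
   simplices. *)
have [e [e0 eE]] : exists e : R, 0 < e /\ (1 - e) / D = e * S.
  have p : 0 < 1 + D * S by rewrite ltr_wpDr// mulr_ge0// ltW.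
  exists (1 + D * S)^-1; split; first by rewrite invr_gt0.
  by field; rewrite !gt_eqF.
have eS0 : 0 <= e * S by rewrite mulr_ge0// ltW.
have sumF : \sum_(i in F) (e * S) = 1 - e.
  by rewrite sumr_const -mulr_natr -DE -eE divfK// gt_eqF.
pose x := \sum_(i in F) (e * S) *: vtx i + e *: vtx j.
pose cK i : R := if i == j then e else if i \in F then e * S else 0.
have jNF i : i \in F -> (i == j) = false.
  by move=> iF; apply: contraNF jF => /eqP <-.
have mNF i : i \in F -> (i == m) = false.
  by move=> iF; apply: contraNF mF => /eqP <-.
have cK1 : \sum_(i in j |: F) cK i = 1.
  rewrite big_setU1//= /cK eqxx.
  rewrite (eq_bigr (fun=> e * S)) => [|i iF]; last by rewrite jNF// iF.
  by rewrite sumF addrC subrK.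
have cKx : \sum_(i in j |: F) cK i *: vtx i = x.
  rewrite big_setU1//= /cK eqxx addrC; congr (_ + _).
  by apply: eq_bigr => i iF; rewrite jNF// iF.
have [c [_ c1 cx]] : hull vtx F x.
  apply: sub; split.
    exists cK; split => // i; rewrite /cK.
    by case: ifP => _; [exact: ltW|case: ifP].
  exists (fun i => if i == m then e * mu m else
    if i \in F then e * S + e * mu i else 0); split.
  - move=> i; case: ifP => _; first by rewrite mulr_ge0// ltW.
    case: ifP => // iF; rewrite -mulrDr mulr_ge0 ?(ltW e0)//.
    have : `|mu i| <= S.
      by rewrite /S (bigD1 i)//= lerDl sumr_ge0.
    by rewrite ler_norml => /andP[? _]; lra.
  - rewrite big_setU1//= eqxx.
    rewrite (eq_bigr (fun i => e * S + e * mu i)) => [|i iF]; last by rewrite mNF// iF.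
    rewrite big_split/= sumF -mulr_sumr addrCA -mulrDr.
    by move: mu1; rewrite big_setU1//= => ->; ring.
  - rewrite big_setU1//= eqxx.
    rewrite (eq_bigr (fun i => (e * S) *: vtx i + e *: (mu i *: vtx i))) => [|i iF].
      rewrite big_split/= -[X in _ + (_ + X)]scaler_sumr addrCA -(scalerA e (mu m)) -scalerDr.
      by move: muj; rewrite big_setU1//= => ->.
    by rewrite mNF// iF scalerDl scalerA.
(* The product of [n] with [x - vtx i0] is computed twice: it is 0 because [x] lies in the hull of
   [F], and it is nonzero because [x] has coefficient [e] at [vtx j]. *)
have := dotv_barycentric jF i0F nF cK1 cKx.
rewrite {1}cx -[vtx i0 in LHS]scale1r -c1 scaler_suml -sumrB.
under eq_bigr do rewrite -scalerBr.
rewrite dotv_sumr big1 => [|i iF]; last by rewrite nF// mulr0.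
rewrite /cK eqxx => /eqP; rewrite eq_sym mulf_eq0 (gt_eqF e0) /=.
by rewrite (negPf nj).
Qed.

(** Both normals vanish on the directions of the face, so they are proportional, with factor 1 or -1
    as both are unit vectors. Factor 1 would put the two opposite vertices on the same side of the
    face, against [barycentric_opposite_le0]. *)
Lemma normal_opposite K L : (0 < d)%N ->
  affinely_independent vtx K -> #|K| = d.+1 ->
  affinely_independent vtx L -> #|L| = d.+1 -> #|K :&: L| = d ->
  hull vtx K `&` hull vtx L = hull vtx (K :&: L) ->
  normal vtx K (K :&: L) + normal vtx L (K :&: L) = 0.
Proof.
move=> d0 aiK cK aiL cL; set F := K :&: L => cF hKL.
have FK : F \subset K := finset.subsetIl K L; have FL : F \subset L := finset.subsetIr K L.
have [n1 nF nK] := normalP d0 aiK cK FK cF.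
have [n1' nF' nL] := normalP d0 aiL cL FL cF.
set n := normal vtx K F in n1 nF nK *; set n' := normal vtx L F in n1' nF' nL *.
have vertexOf A : F \subset A -> #|A| = d.+1 ->
    exists2 j, j \notin F & A = j |: F /\ j \in A :\: F.
  move=> FA cA; have /eqP/cards1P[j AFj] : #|A :\: F| = 1%N.
    by rewrite cardsD (finset.setIidPr FA) cA cF subSnn.
  have jAF : j \in A :\: F by rewrite AFj set11.
  exists j; first by have /finset.setDP[] := jAF.
  by split=> //; rewrite -AFj -[in LHS](finset.setID A F) (finset.setIidPr FA) finset.setUC.
have [j jF [KE jKF]] := vertexOf K FK cK; have [m mF [LE mLF]] := vertexOf L FL cL.
have [i0 i0F] : exists i, i \in F by apply/set0Pn; rewrite -card_gt0 cF.
have nj := nK _ _ i0F jKF; have nm := nL _ _ i0F mLF.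
have n0 i : i \in F -> dotv n (vtx i - vtx i0) = 0 by move=> iF; exact: nF.
have n0' i : i \in F -> dotv n' (vtx i - vtx i0) = 0 by move=> iF; exact: nF'.
have [g [b [g1 gx _]]] := barycentric aiK cK.
have [g' [b' [g1' gx' _]]] := barycentric aiL cL.
rewrite {}KE in g1 gx hKL; rewrite {}LE in g1' gx' hKL.
pose c := dotv n' (vtx j - vtx i0) / dotv n (vtx j - vtx i0).
have n'E x : dotv n' (x - vtx i0) = c * dotv n (x - vtx i0).
  rewrite (dotv_barycentric jF i0F n0' (g1 x) (gx x)).
  rewrite (dotv_barycentric jF i0F n0 (g1 x) (gx x)).
  by rewrite mulrCA /c divfK// lt_eqF.
have n'n : n' = c *: n.
  (* By [n'E], the vector [n' - c *: n] is orthogonal to every vector, hence to itself. *)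
  apply/eqP; rewrite -subr_eq0 -dotv_eq0; set w := n' - _.
  have := n'E (w + vtx i0); rewrite addrK => n'w.
  by rewrite {1}/w dotvC dotvBr dotvZr ![dotv w _]dotvC n'w subrr.
have c2 : (c - 1) * (c + 1) = 0.
  by move: n1'; rewrite n'n dotvZl dotvZr n1 => c1; rewrite -[RHS](subrr 1) -{3}c1; ring.
have [c1|] := eqVneq c 1; last first.
  rewrite -subr_eq0 => c1; move/eqP: c2; rewrite mulf_eq0 (negPf c1)/= addr_eq0.
  by move=> /eqP cN; rewrite n'n cN scaleN1r subrr.
have nn' : n' = n by rewrite n'n c1 scale1r.
have hsub : hull vtx (j |: F) `&` hull vtx (m |: F) `<=` hull vtx F by rewrite hKL.
have mu0 := barycentric_opposite_le0 jF mF i0F n0 (ltr0_neq0 nj) hsub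
  (g1' (vtx j)) (gx' (vtx j)).
move: nj; rewrite -{1}nn' (dotv_barycentric mF i0F n0' (g1' (vtx j)) (gx' (vtx j))).
by rewrite ltNge mulr_le0// ltW.
Qed.

End normals.

(** * Polynomials that are constant on an open set *)

Section polynomials.
Variables (R : realType) (d : nat).

Lemma is_poly_continuous q (p : sfield R d) : is_poly q p -> continuous p.
Proof.
move=> [c ->]; apply: continuous_big => [|al _ x]; first exact: add_continuous.
apply: continuousM; first exact: cst_continuous.
apply: continuous_big => [|i _ y]; first exact: mul_continuous.
have cX (z : R) n : {for z, continuous (fun t : R => t ^+ n)} by exact: exprn_continuous.
by apply: (@continuous_comp _ _ _ (fun z : 'rV[R]_d => z 0 i) (fun t => t ^+ al i));
  [exact: coord_continuous|exact: cX].
Qed.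

(* Restricted to a line through a point of U, p is a polynomial in one variable
   with infinitely many roots. *)
Lemma is_poly_eq0_open q (p : sfield R d) (a : R) (U : set 'rV[R]_d) : is_poly q p ->
  open U -> U !=set0 -> (forall x, U x -> p x = a) -> p = cst a.
Proof.
move=> [c pE] oU [y Uy] pU; apply/funext => x.
pose P : {poly R} := \sum_(al : {ffun 'I_d -> 'I_q.+1} | (\sum_i al i <= q)%N)
  (c al)%:P * \prod_i ((y 0 i)%:P + (x 0 i - y 0 i) *: 'X) ^+ al i - a%:P.
have PE t : P.[t] = p (y + t *: (x - y)) - a.
  rewrite hornerD hornerN hornerC horner_sum pE; congr (_ - _).
  apply: eq_bigr => al _; rewrite hornerM hornerC horner_prod; congr (_ * _).
  apply: eq_bigr => i _; rewrite horner_exp hornerD hornerZ hornerX hornerC.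
  by rewrite !mxE [t * _]mulrC.
suff P0 : P = 0.
  apply/eqP; rewrite -subr_eq0; have := PE 1.
  by rewrite P0 horner0 scale1r [y + _]addrC subrK => <-.
have lc : (fun t => y + t *: (x - y)) @ (0 : R) --> y.
  rewrite -[X in _ --> X]addr0 -(scale0r (x - y)); apply: cvgD; first exact: cvg_cst.
  exact: cvgZr_tmp.
have /nbhs_ballP[e /= e0 eU] : \forall t \near (0 : R), U (y + t *: (x - y)).
  by apply: lc; exact: open_nbhs_nbhs.
(* [size P] distinct roots within [e] of 0, one more than the degree of a nonzero [P] allows. *)
pose rt (k : nat) : R := e / 2 / k.+1%:R.
apply: (@roots_geq_poly_eq0 _ _ [seq rt k | k <- iota 0 (size P)]).
- apply/allP => _ /mapP[k _ ->]; rewrite /root PE pU ?subrr//.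
  apply: eU; rewrite /ball /= sub0r normrN gtr0_norm ?divr_gt0//.
  rewrite ltr_pdivrMr// (@lt_le_trans _ _ e)//; first lra.
  by rewrite ler_pMr// ler1n.
- rewrite map_inj_uniq ?iota_uniq// => k l /(mulfI _) => /(_ _)/wrap[].
    by rewrite gt_eqF// divr_gt0.
  by move=> /invr_inj /eqP; rewrite eqr_nat eqSS => /eqP.
- by rewrite size_map size_iota.
Qed.

End polynomials.

(** * The form b_h at the constant 1 and at fields equal almost everywhere *)

Section form_b_theory.
Variables (R : realType) (d : nat) (Omega : set 'rV[R]_d) (Th : triangulation Omega).
Implicit Types (f g rho : sfield R d) (u : vfield R d).

(** The set where the selected polynomial equals 1 is closed, and by [ae_open_dense] its closure
    contains the nonempty interior of the cell. [cell_interior] places that interior in [Omega], the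
    only region where [ae_on] gives information. *)
Lemma restr_cst1 (k : 'I_(ncell Th)) : restr k (cst 1) = cst 1.
Proof.
have [[q pq] pk] : (exists q, is_poly q (restr k (cst 1))) /\
    ae_on k (cst 1) (restr k (cst 1)).
  apply: (@getPex _ [set p | (exists q, is_poly q p) /\ ae_on k (cst 1) p]).
  exists (cst 1); split; last by exists set0; split => // x /= /not_implyP[].
  exists 0%N; exists (fun=> 1); apply/funext => x.
  rewrite (bigD1 [ffun=> ord0])/=; last by rewrite big1// => i _; rewrite ffunE.
  rewrite [X in _ + X]big1 => [|al /andP[_ /eqP[]]]; last first.
    by apply/ffunP => i; rewrite ffunE; exact: ord1.
  by rewrite mul1r addr0 big1// => i _; rewrite ffunE expr0.
set p := restr k (cst 1) in pq pk *.
pose U := interior (hull (@vertex _ _ _ Th) (cell k)).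
have oU : open U by exact: open_interior.
have U0 : U !=set0.
  by apply: interior_hull_nonempty; [exact: cell_nondegenerate|exact: card_cell].
apply: (is_poly_eq0_open pq oU U0) => x Ux.
have : closure [set x | p x = 1] x.
  apply: (ae_open_dense oU _ Ux); apply: filterS pk => z pz Uz; rewrite /= -pz//.
  by split; [exact: interior_subset|exact: cell_interior Uz].
have : closed [set x | p x = 1].
  have -> : [set x | p x = 1] = p @^-1` [set 1] by [].
  by apply: preimage_closed => [z _|]; [exact: (is_poly_continuous pq)|exact: closed_eq].
by move=> + cx; exact.
Qed.

Lemma form_b_cst1 rho u : (0 < d)%N -> form_b Th (cst 1) rho u = 0.
Proof.
move=> d0; rewrite /form_b big1 => [|k _]; last first.
  rewrite restr_cst1 /Rintegral integral0_eq// => x _.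
  rewrite big1 ?mul0r// => i _.
  by rewrite /partial derive_cst mulr0.
rewrite oppr0 add0r big1// => k _; rewrite big1// => l /and3P[kl /eqP ckl _].
rewrite /face_integral /Rintegral integral0_eq ?mulr0// => x _.
rewrite /jump !restr_cst1 !scale1r normal_opposite ?dotv0r ?mul0r//.
- exact: cell_nondegenerate.
- exact: card_cell.
- exact: cell_nondegenerate.
- exact: card_cell.
- exact: cell_conforming.
Qed.

(** Both fields have the same set of candidates, so [get] selects the same polynomial: the traces
    are equal as functions, not merely almost everywhere. *)
Lemma restr_aeq (k : 'I_(ncell Th)) f g : aeq Omega f g -> restr k f = restr k g.
Proof.
move=> fg; rewrite /restr; congr get; apply/seteqP.
have sub f' g' p : aeq Omega f' g' -> ae_on k f' p -> ae_on k g' p.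
  by move=> h h'; apply: filterS2 h h' => x + + [Kx Ox] => <-//; apply.
split => p [pq pk]; split => //; first exact: sub pk.
by apply: sub pk; apply: filterS fg => x h Ox; rewrite h.
Qed.

(** Serves to drop a projector inside b_h, since pi_h is the identity on V_h only almost
    everywhere. *)
Lemma form_b_aeq f g rho u : aeq Omega f g -> form_b Th f rho u = form_b Th g rho u.
Proof.
move=> fg; have rE (k : 'I_(ncell Th)) := restr_aeq k fg.
rewrite /form_b; apply: (f_equal2 (fun x y => - x + y)).
  by apply: eq_bigr => k _; rewrite rE.
apply: eq_bigr => k _; apply: eq_bigr => l _.
apply: (f_equal (face_integral _ _)).
by apply/funext => x; rewrite /jump !rE.
Qed.

End form_b_theory.

(** * Derivatives of curves in L^2(Omega) *)

Section curves_theory.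
Variables (R : realType) (d : nat) (Omega : set 'rV[R]_d).
Hypothesis mO : measurable Omega.
Local Notation L2 := (L2 Omega).
Local Notation ip := (ip Omega).
Local Notation vip := (vip Omega).
Local Notation L2norm := (L2norm Omega).
Implicit Types (f g : R -> sfield R d) (a b h : sfield R d).

(** Properness gives uniqueness of limits, hence of derivatives. A nearby point of the interval is
    found to the right of [t], except at [t1], where it is found to the left. *)
Lemma within_dnbhs_itv_proper (t0 t1 t : R) : t0 < t1 -> `[t0, t1]%classic t ->
  ProperFilter (within `[t0, t1]%classic t^').
Proof.
move=> t01; rewrite /= in_itv /= => /andP[t0t tt1].
apply: Build_ProperFilter_ex => B.
rewrite /within /= => /nbhs_ballP[e /= e0 eB].
have [tl|tl] := ltP t t1.
  exists (Num.min (t + e / 2) t1); have e2 : 0 < e / 2 by lra.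
  have tm : t < Num.min (t + e / 2) t1 by rewrite lt_min tl andbT; lra.
  apply: eB; rewrite /= ?in_itv /= ?gt_eqF//.
    rewrite /ball /= ltr0_norm ?subr_lt0// opprB.
    by rewrite ltrBlDl (@le_lt_trans _ _ (t + e / 2)) ?ge_min ?lexx//; lra.
  by rewrite ge_min lexx orbT (le_trans t0t (ltW tm)).
have {tl}tE : t = t1 by apply/eqP; rewrite eq_le tt1.
exists (Num.max (t - e / 2) t0); have e2 : 0 < e / 2 by lra.
have tm : Num.max (t - e / 2) t0 < t by rewrite gt_max; lra.
apply: eB; rewrite /= ?in_itv /= ?lt_eqF//.
  rewrite /ball /= gtr0_norm ?subr_gt0//.
  by rewrite ltrBlDl -ltrBlDr (@lt_le_trans _ _ (t - e / 2)) ?le_max ?lexx//; lra.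
by rewrite le_max lexx orbT /=; lra.
Qed.

Section filtered.
Context {F : set_system R} {FF : Filter F}.

Lemma cvg_le_norm (phi D : R -> R) (l : R) :
  (\forall s \near F, `|phi s - l| <= D s) -> D s @[s --> F] --> 0 ->
  phi s @[s --> F] --> l.
Proof.
move=> le D0; apply/cvgrPdist_lt => e e0.
near=> s; rewrite distrC (@le_lt_trans _ _ (D s))//; near: s => //.
exact: (cvgr_lt _ D0 _ e0).
Unshelve. all: by end_near. Qed.

Lemma cvg_ip f g a b : L2 a -> L2 b ->
  (\forall s \near F, L2 (f s)) -> (\forall s \near F, L2 (g s)) ->
  L2norm (f s - a) @[s --> F] --> 0 -> L2norm (g s - b) @[s --> F] --> 0 ->
  ip (f s) (g s) @[s --> F] --> ip a b.
Proof.
move=> La Lb Lf Lg fa gb.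
apply: (@cvg_le_norm _ (fun s => L2norm (f s - a) * L2norm (g s - b) +
  (L2norm a * L2norm (g s - b) + L2norm (f s - a) * L2norm b))).
  near=> s; have Lfs : L2 (f s) by near: s.
  have Lgs : L2 (g s) by near: s.
  have Lfa : L2 (f s - a) by exact: L2B.
  have Lgb : L2 (g s - b) by exact: L2B.
  rewrite (_ : ip (f s) (g s) - ip a b =
    ip (f s - a) (g s - b) + (ip a (g s - b) + ip (f s - a) b)); last first.
    by rewrite (ipBl mO Lfs La Lgb) !ipBr// ipBl//; ring.
  apply: le_trans (ler_normD _ _) _; apply: lerD; first exact: ip_CS.
  by apply: le_trans (ler_normD _ _) _; apply: lerD; exact: ip_CS.
rewrite -[X in _ --> X](_ : 0 * 0 + (L2norm a * 0 + 0 * L2norm b) = 0); last by ring.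
apply: cvgD; first exact: cvgM.
by apply: cvgD; apply: cvgM => //; exact: cvg_cst.
Unshelve. all: by end_near. Qed.

End filtered.

Section derivatives.
Variables (I : set R) (t : R).
Hypothesis It : I t.
Local Notation F := (within I t^').

Lemma near_within : \forall s \near F, I s.
Proof. exact: near_withinT. Qed.

Lemma near_within_neq : \forall s \near F, s != t.
Proof. exact: (cvg_within _ (nbhs_dnbhs_neq t)). Qed.

Lemma cvg_within_sub : (s - t) @[s --> F] --> (0 : R).
Proof.
rewrite -(subrr t); apply: cvgB; last exact: cvg_cst.
by apply: cvg_trans (cvg_within _) _; exact: nbhs_dnbhs.
Qed.

Lemma has_deriv_withinD (phi psi : R -> R) l m : has_deriv_within I phi t l ->
  has_deriv_within I psi t m -> has_deriv_within I (fun s => phi s + psi s) t (l + m).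
Proof.
move=> hl hm; rewrite /has_deriv_within.
rewrite (_ : (fun s => _) = (fun s => (s - t)^-1 * (phi s - phi t) +
  (s - t)^-1 * (psi s - psi t))); first exact: cvgD.
by apply/funext => s; ring.
Qed.

Lemma has_deriv_withinN (phi : R -> R) l : has_deriv_within I phi t l ->
  has_deriv_within I (fun s => - phi s) t (- l).
Proof.
move=> hl; rewrite /has_deriv_within.
rewrite (_ : (fun s => _) = (fun s => - ((s - t)^-1 * (phi s - phi t)))).
  exact: cvgN.
by apply/funext => s; ring.
Qed.

Lemma has_deriv_within_sum (J : finType) (phi : J -> R -> R) l :
  (forall j, has_deriv_within I (phi j) t (l j)) ->
  has_deriv_within I (fun s => \sum_j phi j s) t (\sum_j l j).
Proof.
move=> hl; rewrite /has_deriv_within.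
rewrite (_ : (fun s => _) = (fun s => \sum_j ((s - t)^-1 * (phi j s - phi j t)))).
  by apply: cvg_big => [|j _]; [exact: add_continuous|exact: hl].
by apply/funext => s; rewrite -sumrB mulr_sumr.
Qed.

(** Representatives are not unique, so only the distance of [a] and [b] vanishes; [ip_aeq] makes
    this enough for inner products. *)
Lemma is_dt_unique f a b : ProperFilter F -> (forall s, I s -> L2 (f s)) ->
  is_dt Omega I f t a -> is_dt Omega I f t b -> L2norm (a - b) = 0.
Proof.
move=> PF Lf [La fa] [Lb fb].
have h : (fun=> L2norm (a - b)) @ F --> (0 : R).
  apply: (@cvg_le_norm F _ _ (fun s => L2norm ((s - t)^-1 *: (f s - f t) - a) +
    L2norm ((s - t)^-1 *: (f s - f t) - b))); last by rewrite -[X in _ --> X]addr0; exact: cvgD.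
  near=> s; have Is : I s by near: s; exact: near_within.
  set q := _ *: _; have Lq : L2 q by apply: L2Z => //; apply: L2B => //; exact: Lf.
  have Lqa : L2 (q - a) by exact: L2B. have Lqb : L2 (q - b) by exact: L2B.
  rewrite subr0 ger0_norm ?L2norm_ge0// -(L2normN mO Lqa).
  have -> : a - b = - (q - a) + (q - b) by rewrite opprB addrA subrK.
  by apply: L2norm_triangle => //; exact: L2N.
by apply: (cvg_unique (@norm_hausdorff _ R) (cvg_cst _) h).
Unshelve. all: by end_near. Qed.

Lemma near_L2_diff_quotient f : (forall s, I s -> L2 (f s)) ->
  \forall s \near F, L2 ((s - t)^-1 *: (f s - f t)).
Proof.
move=> Lf; near=> s; have Is : I s by near: s; exact: near_within.
by apply: L2Z => //; apply: L2B => //; exact: Lf.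
Unshelve. all: by end_near. Qed.

(** With difference quotients F and G of [f] and [g], the quotient of the product is <F, g t> + <f
    t, G> + (s - t) <F, G>, and the last term tends to 0. *)
Lemma has_deriv_within_ip f g a b :
  (forall s, I s -> L2 (f s)) -> (forall s, I s -> L2 (g s)) ->
  is_dt Omega I f t a -> is_dt Omega I g t b ->
  has_deriv_within I (fun s => ip (f s) (g s)) t (ip a (g t) + ip (f t) b).
Proof.
move=> Lf Lg fa gb; have Lqf := near_L2_diff_quotient Lf.
have Lqg := near_L2_diff_quotient Lg.
have Lft := Lf _ It; have Lgt := Lg _ It.
have L0 h : L2norm (h - h) @[_ --> F] --> (0 : R).
  have -> : L2norm (h - h) = 0.
    by rewrite subrr -(scale0r h) /L2norm /ip /Rintegral integral0_eq ?sqrtr0// => x _;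
       rewrite scale0r mul0r.
  exact: cvg_cst.
have h1 : ip ((s - t)^-1 *: (f s - f t)) (g t) @[s --> F] --> ip a (g t).
  apply: (@cvg_ip F _ _ (fun=> g t)) => //; [exact: fa.1|exact: nearW|exact: fa.2].
have h2 : ip (f t) ((s - t)^-1 *: (g s - g t)) @[s --> F] --> ip (f t) b.
  apply: (@cvg_ip F _ (fun=> f t)) => //; [exact: gb.1|exact: nearW|exact: gb.2].
have h3 : ip ((s - t)^-1 *: (f s - f t)) ((s - t)^-1 *: (g s - g t)) @[s --> F]
    --> ip a b.
  by apply: cvg_ip => //; [exact: fa.1|exact: gb.1|exact: fa.2|exact: gb.2].
rewrite /has_deriv_within.
rewrite -[X in _ --> X]addr0 -[X in _ --> _ + X](mul0r (ip a b)).
apply: cvg_trans (cvgD (cvgD h1 h2) (cvgM cvg_within_sub h3)).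
apply: near_eq_cvg; near=> s.
have Is : I s by near: s; exact: near_within.
have st : s != t by near: s; exact: near_within_neq.
have st0 : s - t != 0 by rewrite subr_eq0.
have Lfs := Lf _ Is; have Lgs := Lg _ Is.
have Lfd : L2 (f s - f t) by exact: L2B.
have Lgd : L2 (g s - g t) by exact: L2B.
have Lq := L2Z mO (s - t)^-1 Lgd.
rewrite !fctE /= !ipZl// !ipZr// !ipBl// !ipBr//.
by field.
Unshelve. all: by end_near. Qed.

Lemma has_deriv_within_ipl f a h : (forall s, I s -> L2 (f s)) -> L2 h ->
  is_dt Omega I f t a -> has_deriv_within I (fun s => ip (f s) h) t (ip a h).
Proof.
move=> Lf Lh fa; rewrite -[ip a h]addr0 -(_ : ip (f t) 0 = 0).
  apply: (@has_deriv_within_ip f (fun=> h)) => //; split.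
    by rewrite -(scale0r h); exact: L2Z.
  have -> : (fun s => L2norm ((s - t)^-1 *: (h - h) - 0)) = fun=> 0.
    apply/funext => s; rewrite subrr scaler0 subr0 /L2norm /ip /Rintegral.
    by rewrite integral0_eq ?sqrtr0// => x _; rewrite mul0r.
  exact: cvg_cst.
by rewrite -(scale0r h) ipZr ?mul0r//; exact: Lf.
Qed.

End derivatives.
End curves_theory.

(** * Composition of Frechet differentiable maps with curves of states *)

Section states.
Variables (R : realType) (d : nat) (Omega : set 'rV[R]_d).
Hypothesis mO : measurable Omega.
Local Notation L2 := (L2 Omega).
Local Notation ip := (ip Omega).
Local Notation vip := (vip Omega).
Local Notation L2norm := (L2norm Omega).
Local Notation state_norm := (state_norm Omega).
Implicit Types (f g h : sfield R d) (z w : state R d).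

(** Dominates [state_norm] and inherits triangle inequality and homogeneity directly from [L2norm].
    Only upper bounds of [state_norm] are ever required, so all estimates are made in this norm. *)
Definition sum_norm z : R :=
  \sum_i L2norm (z.1.1 i) + L2norm z.1.2 + L2norm z.2.

Definition L2_state z : Prop := (forall i, L2 (z.1.1 i)) /\ L2 z.1.2 /\ L2 z.2.

Lemma sumr_sqr_le (J : finType) (x : J -> R) : (forall j, 0 <= x j) ->
  \sum_j x j ^+ 2 <= (\sum_j x j) ^+ 2.
Proof.
move=> x0; suff [] : 0 <= \sum_j x j /\ \sum_j x j ^+ 2 <= (\sum_j x j) ^+ 2 by [].
apply: (big_ind2 (fun a b => 0 <= a /\ b <= a ^+ 2)).
- by split; nra.
- by move=> a b a' b' [? ?] [? ?]; split; nra.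
- by move=> j _; split.
Qed.

Lemma sum_norm_ge0 z : 0 <= sum_norm z.
Proof. by rewrite !addr_ge0 ?L2norm_ge0// sumr_ge0// => i _; exact: L2norm_ge0. Qed.

Lemma state_norm_le z : state_norm z <= sum_norm z.
Proof.
rewrite -(ger0_norm (sum_norm_ge0 z)) -sqrtr_sqr ler_wsqrtr// /sum_norm.
rewrite /vip -!sqr_L2norm.
under eq_bigr do rewrite -sqr_L2norm.
have := @sumr_sqr_le _ (fun i => L2norm (z.1.1 i)) (fun i => L2norm_ge0 _ _).
have : 0 <= \sum_i L2norm (z.1.1 i) by rewrite sumr_ge0// => i _; exact: L2norm_ge0.
have := L2norm_ge0 Omega z.1.2; have := L2norm_ge0 Omega z.2.
move: (\sum_i _ ^+ 2) (\sum_i _) (L2norm _) (L2norm _) => a b x y.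
nra.
Qed.

Lemma sum_norm_triangle z w : L2_state z -> L2_state w ->
  sum_norm (z + w) <= sum_norm z + sum_norm w.
Proof.
move=> [Lz1 [Lz2 Lz3]] [Lw1 [Lw2 Lw3]]; rewrite /sum_norm.
have h2 := L2norm_triangle mO Lz2 Lw2; have h3 := L2norm_triangle mO Lz3 Lw3.
have h1 : \sum_i L2norm ((z + w).1.1 i) <=
    \sum_i L2norm (z.1.1 i) + \sum_i L2norm (w.1.1 i).
  by rewrite -big_split; apply: ler_sum => i _; exact: L2norm_triangle.
apply: le_trans (lerD (lerD h1 h2) h3) _.
by rewrite le_eqVlt; apply/orP; left; apply/eqP; ring.
Qed.

Lemma sum_normZ a z : L2_state z -> sum_norm (a *: z) = `|a| * sum_norm z.
Proof.
move=> [Lz1 [Lz2 Lz3]]; rewrite /sum_norm !mulrDr mulr_sumr -(L2normZ mO a Lz2) -(L2normZ mO a Lz3).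
by congr (_ + _ + _); apply: eq_bigr => i _; rewrite -(L2normZ mO a (Lz1 i)).
Qed.

Variable S : set (state R d).
Hypothesis S_linear : forall (a : R) z w, S z -> S w -> S (a *: z + w).
Hypothesis S_L2 : forall z, S z -> L2_state z.

Lemma state_subB z w : S z -> S w -> S (z - w).
Proof. by move=> Sz Sw; rewrite addrC -scaleN1r; exact: S_linear. Qed.

Lemma state_subZ a z : S z -> S (a *: z).
Proof.
move=> Sz; rewrite -[_ *: _]addr0; apply: S_linear => //.
by rewrite -(subrr z); exact: state_subB.
Qed.

Section curve.
Variables (I : set R) (t : R) (z : R -> state R d) (zd : state R d).
Hypotheses (It : I t) (Sz : forall s, I s -> S (z s)) (Szd : S zd).
Local Notation F := (within I t^').
Hypothesis z_dt :
  sum_norm ((s - t)^-1 *: (z s - z t) - zd) @[s --> F] --> (0 : R).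

Lemma near_sum_norm_quotient :
  \forall s \near F, sum_norm ((s - t)^-1 *: (z s - z t)) <= sum_norm zd + 1.
Proof.
near=> s; have Is : I s by near: s; exact: near_within.
have Sq : S ((s - t)^-1 *: (z s - z t)).
  by apply: state_subZ; apply: state_subB; exact: Sz.
rewrite -[X in sum_norm X](subrK zd) addrC.
apply: le_trans (sum_norm_triangle (S_L2 Szd) (S_L2 (state_subB Sq Szd))) _.
rewrite lerD2l ltW//; near: s; exact: (cvgr_lt _ z_dt _ ltr01).
Unshelve. all: by end_near. Qed.

(** The increment is [s - t] times the difference quotient, which is bounded near [t]. *)
Lemma near_sum_norm_increment (e : R) : 0 < e ->
  \forall s \near F, sum_norm (z s - z t) < e.
Proof.
move=> e0; have C0 : 0 < sum_norm zd + 1 by rewrite ltr_wpDl// sum_norm_ge0.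
have e1 : 0 < e / (sum_norm zd + 1) by rewrite divr_gt0.
near=> s; have Is : I s by near: s; exact: near_within.
have st : s != t by near: s; exact: near_within_neq.
have st0 : s - t != 0 by rewrite subr_eq0.
have Sd : S (z s - z t) by apply: state_subB; exact: Sz.
rewrite -[z s - z t](scale1r) -(divff st0) -scalerA sum_normZ; last first.
  by apply: S_L2; exact: state_subZ.
have small : `|s - t| < e / (sum_norm zd + 1).
  near: s;
  exact: (cvgr0_norm_lt _ (@cvg_within_sub _ I t) _ e1).
apply: (@le_lt_trans _ _ (`|s - t| * (sum_norm zd + 1))).
  rewrite ler_wpM2l//; near: s; exact: near_sum_norm_quotient.
by rewrite -ltr_pdivlMr.
Unshelve. all: by end_near. Qed.

(* The difference quotient of [G \o z] is [L] applied to that of [z], up to the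
   remainder of the Frechet expansion. *)
Lemma frechet_is_dt (G : state R d -> sfield R d) (L : state R d -> sfield R d) :
  (forall s, I s -> L2 (G (z s))) -> frechet Omega S G (z t) L ->
  is_dt Omega I (fun s => G (z s)) t (L zd).
Proof.
move=> LG [LL2 Llin [C Lbound] Lexp]; split; first exact: LL2.
have C0 w : S w -> L2norm (L w) <= `|C| * sum_norm w.
  move=> Sw; apply: le_trans (Lbound _ Sw) _.
  apply: (@le_trans _ _ (`|C| * state_norm w)).
    by rewrite ler_wpM2r ?sqrtr_ge0// ler_norm.
  by rewrite ler_wpM2l// state_norm_le.
(* [L] is linear only up to null sets, so the defect of linearity is a field of norm zero rather
   than zero. The relation [e0] says that [L 0] vanishes almost everywhere. *)
have Lq (a : R) w : S w ->
    L2norm (a *: L w - L zd - L (a *: w - zd)) = 0.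
  move=> Sw; have Saw := state_subZ a Sw; have Sd := state_subB Saw Szd.
  have e := Llin 1 _ _ Sd Szd.
  have e' := Llin a _ _ Sw (state_subB Szd Szd).
  have e0 := Llin (- 1) _ _ Szd Szd.
  rewrite scale1r subrK in e; rewrite subrr addr0 in e'.
  rewrite scaleN1r addNr in e0.
  apply: aeq_L2norm0; [exact: mO| |exact: LL2|].
    by apply: L2B => //; [apply: L2Z => //; exact: LL2|exact: LL2].
  apply: filterS3 e e' e0 => x h1 h2 h3 Ox.
  move: (h1 Ox) (h2 Ox) (h3 Ox); rewrite !fctE /GRing.scale /=; lra.
apply/cvgrPdist_lt => e e0.
pose M := sum_norm zd + 1.
have M0 : 0 < M by rewrite ltr_wpDl// sum_norm_ge0.
(* Since [M] bounds the difference quotient, the Frechet remainder divided by [s - t] is at most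
   [e1 * M], half of the tolerance. *)
pose e1 := e / 2 / M.
have e10 : 0 < e1 by rewrite !divr_gt0.
have [del del0 expd] := Lexp _ e10.
have e2 : 0 < e / 2 by rewrite divr_gt0.
have Cw : `|C| * sum_norm ((s - t)^-1 *: (z s - z t) - zd) @[s --> F] --> (0 : R).
  by rewrite -(mulr0 `|C|); apply: cvgM => //; exact: cvg_cst.
near=> s; have Is : I s by near: s; exact: near_within.
have Sd : S (z s - z t) by apply: state_subB; exact: Sz.
have hdel : sum_norm (z s - z t) < del by near: s; exact: near_sum_norm_increment.
have qM : sum_norm ((s - t)^-1 *: (z s - z t)) <= M.
  by near: s; exact: near_sum_norm_quotient.
have wE : `|C| * sum_norm ((s - t)^-1 *: (z s - z t) - zd) < e / 2.
  near: s; exact: (cvgr_lt _ Cw _ e2).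
move: hdel qM wE; set al := (s - t)^-1; set h := z s - z t in Sd * => hdel qM wE.
have Lh := LL2 _ Sd; have Lzd := LL2 _ Szd.
have Sq := state_subZ al Sd; have Sw := state_subB Sq Szd.
have Lw := LL2 _ Sw.
pose rem := G (z s) - G (z t) - L h.
have Lrem : L2 rem by apply: L2B => //; apply: L2B => //; exact: LG.
have remE : L2norm rem <= e1 * sum_norm h.
  have -> : rem = G (z t + h) - G (z t) - L h by rewrite /h [z t + _]addrC subrK.
  apply: le_trans (expd _ Sd _) _; last by rewrite ler_wpM2l ?state_norm_le// ltW.
  apply: le_lt_trans (state_norm_le _) _.
  exact: hdel.
rewrite sum_normZ in qM; last exact: S_L2.
rewrite sub0r normrN ger0_norm ?L2norm_ge0//.
(* Three parts: the scaled remainder, [L] at the error of the difference quotient of [z], and the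
   defect of linearity. *)
have -> : al *: (G (z s) - G (z t)) - L zd =
    al *: rem + (L (al *: h - zd) + (al *: L h - L zd - L (al *: h - zd))).
  by rewrite /rem [al *: (_ - _ - _)]scalerBr [L _ + _]addrC subrK addrA subrK.
have LE : L2 (al *: L h - L zd - L (al *: h - zd)).
  by do 2![apply: L2B => //]; exact: L2Z.
apply: le_lt_trans (L2norm_triangle mO (L2Z mO al Lrem) (L2D mO Lw LE)) _.
rewrite L2normZ//; have := L2norm_triangle mO Lw LE; rewrite Lq//.
have := C0 _ Sw.
have : `|al| * L2norm rem <= e / 2.
  rewrite (_ : e / 2 = e1 * M); last by rewrite /e1 divfK// gt_eqF.
  apply: le_trans (ler_wpM2l (normr_ge0 al) remE) _.
  by rewrite mulrCA ler_wpM2l// ltW.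
lra.
Unshelve. all: by end_near. Qed.

End curve.
End states.

(** * The chain rule for the Lagrangian *)

Section chain_rule.
Variables (R : realType) (d : nat) (Omega : set 'rV[R]_d).
Hypothesis mO : measurable Omega.
Local Notation L2 := (L2 Omega).
Local Notation ip := (ip Omega).
Local Notation vip := (vip Omega).
Local Notation L2norm := (L2norm Omega).
Local Notation sum_norm := (sum_norm Omega).
Local Notation L2_state := (L2_state Omega).

(** With [l] the triple of functional derivatives, this is the differential of [ell] in the
    direction [k]. *)
Definition pairing (l k : state R d) : R :=
  vip l.1.1 k.1.1 + ip l.1.2 k.1.2 + ip l.2 k.2.

Lemma pairingZr a l k : L2_state l -> L2_state k ->
  pairing l (a *: k) = a * pairing l k.
Proof.
move=> [l1 [l2 l3]] [k1 [k2 k3]].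
have h2 := ipZr mO a k2 l2; have h3 := ipZr mO a k3 l3.
have h1 : vip l.1.1 (a *: k).1.1 = a * vip l.1.1 k.1.1.
  by rewrite /vip mulr_sumr; apply: eq_bigr => i _; exact: (ipZr mO a (k1 i) (l1 i)).
by rewrite /pairing !mulrDr -h1 -h2 -h3.
Qed.

Lemma pairingBr l k k' : L2_state l -> L2_state k -> L2_state k' ->
  pairing l (k - k') = pairing l k - pairing l k'.
Proof.
move=> [l1 [l2 l3]] [k1 [k2 k3]] [k1' [k2' k3']].
have h2 := ipBr mO k2 k2' l2; have h3 := ipBr mO k3 k3' l3.
have h1 : vip l.1.1 (k - k').1.1 = vip l.1.1 k.1.1 - vip l.1.1 k'.1.1.
  by rewrite /vip -sumrB; apply: eq_bigr => i _; exact: (ipBr mO (k1 i) (k1' i) (l1 i)).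
transitivity (vip l.1.1 k.1.1 - vip l.1.1 k'.1.1 + (ip l.1.2 k.1.2 - ip l.1.2 k'.1.2) +
  (ip l.2 k.2 - ip l.2 k'.2)); first by rewrite -h1 -h2 -h3.
by rewrite /pairing; ring.
Qed.

Lemma L2norm_le_sum_norm1 (l : state R d) i : L2norm (l.1.1 i) <= sum_norm l.
Proof.
rewrite /sum_norm (bigD1 i)//= -!addrA lerDl !addr_ge0 ?L2norm_ge0//.
by apply: sumr_ge0 => j _; exact: L2norm_ge0.
Qed.

Lemma pairing_le l k : L2_state l -> L2_state k ->
  `|pairing l k| <= sum_norm l * sum_norm k.
Proof.
move=> [l1 [l2 l3]] [k1 [k2 k3]].
have lu i := L2norm_le_sum_norm1 l i.
have u0 : 0 <= \sum_i L2norm (l.1.1 i) by apply: sumr_ge0 => j _; exact: L2norm_ge0.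
have l20 := L2norm_ge0 Omega l.1.2; have l30 := L2norm_ge0 Omega l.2.
have lr : L2norm l.1.2 <= sum_norm l by rewrite /sum_norm; lra.
have ls : L2norm l.2 <= sum_norm l by rewrite /sum_norm; lra.
have le f g : L2 f -> L2 g -> L2norm f <= sum_norm l ->
    `|ip f g| <= sum_norm l * L2norm g.
  move=> Lf Lg fl; apply: le_trans (ip_CS mO Lf Lg) _.
  by rewrite ler_wpM2r// L2norm_ge0.
rewrite (_ : sum_norm l * sum_norm k = \sum_i sum_norm l * L2norm (k.1.1 i) +
  sum_norm l * L2norm k.1.2 + sum_norm l * L2norm k.2); last first.
  by rewrite {2}/sum_norm !mulrDr mulr_sumr.
apply: le_trans (ler_normD _ _) _; apply: lerD; last exact: le.
apply: le_trans (ler_normD _ _) _; apply: lerD; last exact: le.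
apply: le_trans (ler_norm_sum _ _ _) _.
by apply: ler_sum => i _; exact: le.
Qed.

(** The derivative is taken at 0 of the shifted function because functional derivatives are given at
    [e = 0] along a segment that starts at the current state. *)
Lemma mvt01 (phi dphi : R -> R) :
  (forall th : R, 0 <= th <= 1 ->
    is_derive (0 : R) (1 : R) (fun e => phi (th + e)) (dphi th)) ->
  exists2 th : R, 0 <= th <= 1 & phi 1 - phi 0 = dphi th.
Proof.
move=> dphiE.
have der (th : R) : 0 <= th <= 1 -> is_derive th (1 : R) phi (dphi th).
  move=> /dphiE [ex val].
  have E : (fun h : R => h^-1 *: (((fun e => phi (th + e)) \o shift (0 : R)) (h *: 1) -
      phi (th + 0))) = (fun h : R => h^-1 *: ((phi \o shift th) (h *: 1) - phi th)).
    by apply/funext => h /=; rewrite !addr0 [th + _]addrC.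
  by split; [move: ex; rewrite /derivable E|move: val; rewrite /derive E].
have [|||c] := @MVT R phi dphi 0 1.
- exact: ltr01.
- by move=> x; rewrite in_itv /= => /andP[x0 x1]; apply: der; rewrite !ltW.
- apply: derivable_within_continuous => x; rewrite in_itv /= => xI.
  by have [] := der _ xI.
by rewrite in_itv /= subr0 mulr1 => /andP[c0 c1] ->; exists c; rewrite ?ltW.
Qed.

Variables (U : set (vfield R d)) (V : set (sfield R d)).
Hypotheses (U_linear : forall (a : R) u v, U u -> U v -> U (a *: u + v))
  (V_linear : forall (a : R) f g, V f -> V g -> V (a *: f + g))
  (U_L2 : forall u, U u -> forall i, L2 (u i)) (V_L2 : forall f, V f -> L2 f).
Let S : set (state R d) := (U `*` V) `*` V.

Lemma prod_state_L2 z : S z -> L2_state z.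
Proof. by move=> [[/U_L2 ? /V_L2 ?] /V_L2 ?]. Qed.

Lemma prod_state_linear (a : R) z w : S z -> S w -> S (a *: z + w).
Proof.
move=> [[z1 z2] z3] [[w1 w2] w3]; have h1 := U_linear a z1 w1.
have h2 := V_linear a z2 w2; have h3 := V_linear a z3 w3.
exact: (conj (conj h1 h2) h3).
Qed.

Variables (D : set (state R d)) (X : set (vfield R d)) (Y : set (sfield R d)).
Hypotheses (UX : U `<=` X) (VY : V `<=` Y).
Variables (ell : state R d -> R).
Variables (lu : state R d -> vfield R d) (lr ls : state R d -> sfield R d).
Hypothesis ell_deriv : functional_derivatives Omega D X Y ell lu lr ls.
Let grd z : state R d := (lu z, lr z, ls z).

Lemma grd_L2 z : D z -> L2_state (grd z).
Proof. by case: z => [[u rho] s] /ell_deriv [[? ? ?] _]. Qed.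

Let scaled (h : state R d) (a b c : R) : state R d :=
  (a *: h.1.1, b *: h.1.2, c *: h.2).

Lemma scaled_state h a b c : S h -> S (scaled h a b c).
Proof.
move=> [[h1 h2] h3]; have U0 : U 0.
  by rewrite -(addNr h.1.1) -scaleN1r; exact: U_linear.
have V0 : V 0 by rewrite -(addNr h.1.2) -scaleN1r; exact: V_linear.
have e1 := U_linear a h1 U0; have e2 := V_linear b h2 V0.
have e3 := V_linear c h3 V0; rewrite !addr0 in e1 e2 e3.
exact: (conj (conj e1 e2) e3).
Qed.

(** Keeps the path of [ell_increment] in the ball where membership in [D] and the bounds on the
    functional derivatives are available. *)
Lemma sum_norm_scaled h a b c : L2_state h -> 0 <= a <= 1 -> 0 <= b <= 1 ->
  0 <= c <= 1 -> sum_norm (scaled h a b c) <= sum_norm h.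
Proof.
move=> [h1 [h2 h3]] a01 b01 c01.
have le f e : L2 f -> 0 <= e <= 1 -> L2norm (e *: f) <= L2norm f.
  move=> Lf /andP[e0 e1]; rewrite L2normZ// ger0_norm//.
  by rewrite ler_piMl// L2norm_ge0.
apply: lerD; last exact: le.
apply: lerD; last exact: le.
by apply: ler_sum => i _; exact: le.
Qed.

(* Mean value theorem on the three segments of the path from [z] to [z + h] that
   moves one argument of [ell] at a time. *)
Lemma ell_increment z h eta : S h ->
  (forall k, S k -> sum_norm k <= sum_norm h -> D (z + k) /\
    [/\ forall i, L2norm (lu (z + k) i - lu z i) <= eta,
      L2norm (lr (z + k) - lr z) <= eta & L2norm (ls (z + k) - ls z) <= eta]) ->
  `|ell (z + h) - ell z - pairing (grd z) h| <= eta * sum_norm h.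
Proof.
move=> Sh hyp; have Lh := prod_state_L2 Sh.
have i0 : 0 <= (0 : R) <= 1 by rewrite lexx ler01.
have i1 : 0 <= (1 : R) <= 1 by rewrite ler01 lexx.
pose w a b c := z + scaled h a b c.
have pt (a b c : R) : 0 <= a <= 1 -> 0 <= b <= 1 -> 0 <= c <= 1 ->
  D (w a b c) /\
  [/\ forall i, L2norm (lu (w a b c) i - lu z i) <= eta,
      L2norm (lr (w a b c) - lr z) <= eta & L2norm (ls (w a b c) - ls z) <= eta].
  by move=> a01 b01 c01; apply: hyp; [exact: scaled_state|exact: sum_norm_scaled].
have w0 : w 0 0 0 = z by rewrite /w /scaled !scale0r; exact: addr0.
have w1 : w 1 1 1 = z + h by rewrite /w /scaled !scale1r; case: (h) => [[]].
have wE a b c : w a b c = (z.1.1 + a *: h.1.1, z.1.2 + b *: h.1.2, z.2 + c *: h.2) by [].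
have Dz : D z by rewrite -w0; exact: (pt 0 0 0 i0 i0 i0).1.
have [Lz1 [Lz2 Lz3]] := grd_L2 Dz; have [Lh1 [Lh2 Lh3]] := Lh.
have dE x (Dx : D x) : [/\
    is_derive (0 : R) (1 : R) (fun e : R => ell (x.1.1 + e *: h.1.1, x.1.2, x.2))
      (vip (lu x) h.1.1),
    is_derive (0 : R) (1 : R) (fun e : R => ell (x.1.1, x.1.2 + e *: h.1.2, x.2))
      (ip (lr x) h.1.2) &
    is_derive (0 : R) (1 : R) (fun e : R => ell (x.1.1, x.1.2, x.2 + e *: h.2))
      (ip (ls x) h.2)].
  case: x Dx => [[x1 x2] x3] /ell_deriv[_ [d1 d2 d3]].
  by split; [exact: d1 (UX Sh.1.1)|exact: d2 (VY Sh.1.2)|exact: d3 (VY Sh.2)].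
have [a a01 E1] : exists2 a : R, 0 <= a <= 1 &
    ell (w 1 0 0) - ell (w 0 0 0) = vip (lu (w a 0 0)) h.1.1.
  apply: (@mvt01 (fun a => ell (w a 0 0)) (fun a => vip (lu (w a 0 0)) h.1.1)) => a a01.
  have [+ _ _] := dE _ (pt a 0 0 a01 i0 i0).1.
  rewrite (_ : (fun e : R => _) = (fun e : R => ell (w (a + e) 0 0)))//.
  by apply/funext => e; rewrite !wE scalerDl addrA.
have [b b01 E2] : exists2 b : R, 0 <= b <= 1 &
    ell (w 1 1 0) - ell (w 1 0 0) = ip (lr (w 1 b 0)) h.1.2.
  apply: (@mvt01 (fun b => ell (w 1 b 0)) (fun b => ip (lr (w 1 b 0)) h.1.2)) => b b01.
  have [_ + _] := dE _ (pt 1 b 0 i1 b01 i0).1.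
  rewrite (_ : (fun e : R => _) = (fun e : R => ell (w 1 (b + e) 0)))//.
  by apply/funext => e; rewrite !wE scalerDl addrA.
have [c c01 E3] : exists2 c : R, 0 <= c <= 1 &
    ell (w 1 1 1) - ell (w 1 1 0) = ip (ls (w 1 1 c)) h.2.
  apply: (@mvt01 (fun c => ell (w 1 1 c)) (fun c => ip (ls (w 1 1 c)) h.2)) => c c01.
  have [_ _ +] := dE _ (pt 1 1 c i1 i1 c01).1.
  rewrite (_ : (fun e : R => _) = (fun e : R => ell (w 1 1 (c + e))))//.
  by apply/funext => e; rewrite !wE scalerDl addrA.
have [Da [na _ _]] := pt a 0 0 a01 i0 i0.
have [Db [_ nb _]] := pt 1 b 0 i1 b01 i0.
have [Dc [_ _ nc]] := pt 1 1 c i1 i1 c01.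
have [La _] := grd_L2 Da; have [_ [Lb _]] := grd_L2 Db; have [_ [_ Lc]] := grd_L2 Dc.
have le f g k : L2 f -> L2 g -> L2 k -> L2norm (f - g) <= eta ->
    `|ip f k - ip g k| <= eta * L2norm k.
  move=> Lf Lg Lk fg; rewrite -ipBl//.
  apply: le_trans (ip_CS mO (L2B mO Lf Lg) Lk) _.
  by rewrite ler_wpM2r// L2norm_ge0.
(* The three segments telescope; each intermediate derivative is within [eta] of its value at [z],
   so Cauchy-Schwarz bounds each difference. *)
have -> : ell (z + h) - ell z - pairing (grd z) h =
    (vip (lu (w a 0 0)) h.1.1 - vip (lu z) h.1.1) +
    (ip (lr (w 1 b 0)) h.1.2 - ip (lr z) h.1.2) + (ip (ls (w 1 1 c)) h.2 - ip (ls z) h.2).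
  by rewrite -E1 -E2 -E3 w0 w1 /pairing; ring.
rewrite (_ : eta * sum_norm h = \sum_i eta * L2norm (h.1.1 i) +
  eta * L2norm h.1.2 + eta * L2norm h.2); last first.
  by rewrite /sum_norm !mulrDr mulr_sumr.
apply: le_trans (ler_normD _ _) _; apply: lerD; last exact: le Lc Lz3 Lh3 nc.
apply: le_trans (ler_normD _ _) _; apply: lerD; last exact: le Lb Lz2 Lh2 nb.
rewrite /vip -sumrB; apply: le_trans (ler_norm_sum _ _ _) _.
by apply: ler_sum => i _; exact: le (La i) (Lz1 i) (Lh1 i) (na i).
Qed.

Hypotheses (D_open : open_in Omega S D)
  (lu_cont : forall i, continuous_map Omega S D (fun z => lu z i))
  (lr_cont : continuous_map Omega S D lr) (ls_cont : continuous_map Omega S D ls).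

Lemma near_state z eta : D z -> 0 < eta -> exists2 del, 0 < del &
  forall k, S k -> sum_norm k < del -> D (z + k) /\
    [/\ forall i, L2norm (lu (z + k) i - lu z i) <= eta,
      L2norm (lr (z + k) - lr z) <= eta & L2norm (ls (z + k) - ls z) <= eta].
Proof.
move=> Dz eta0.
have [_ /(_ _ Dz)[e1 e10 h1]] := D_open.
have [_ /(_ _ Dz _ eta0)[e2 e20 h2]] := lr_cont.
have [_ /(_ _ Dz _ eta0)[e3 e30 h3]] := ls_cont.
have /choice[e4 h4] : forall i : 'I_d, exists e4 : R, 0 < e4 /\ forall k, S k ->
    state_norm Omega k < e4 -> L2norm (lu (z + k) i - lu z i) < eta.
  move=> i; have [_ /(_ _ Dz _ eta0)[e4 e40 h4]] := lu_cont i.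
  by exists e4.
(* The [1] is only the value of the empty minimum and the cap on the others. *)
pose e5 : R := \big[Num.min/1]_i e4 i.
exists (Num.min (Num.min e1 e2) (Num.min e3 e5)).
  rewrite !lt_min e10 e20 e30 /=; apply: lt_bigmin => [|i _]; [exact: ltr01|exact: (h4 i).1].
move=> k Sk; rewrite !lt_min => /andP[/andP[k1 k2] /andP[k3 k5]].
have kle := state_norm_le Omega k.
split; first by apply: h1 => //; exact: le_lt_trans k1.
split=> [i||]; apply: ltW.
- apply: (h4 i).2 => //; apply: (le_lt_trans kle); apply: (lt_le_trans k5).
  exact: (bigmin_le_cond _ e4).
- by apply: h2 => //; exact: le_lt_trans k2.
- by apply: h3 => //; exact: le_lt_trans k3.
Qed.

(** The difference quotient splits into the pairing of the gradient with the quotient of [z], and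
    the error bounded by [ell_increment]. *)
Lemma has_deriv_within_ell (I : set R) (t : R) (z : R -> state R d) (zd : state R d) :
  I t -> (forall s, I s -> S (z s)) -> S zd -> (forall s, I s -> D (z s)) ->
  sum_norm ((s - t)^-1 *: (z s - z t) - zd) @[s --> within I t^'] --> (0 : R) ->
  has_deriv_within I (fun s => ell (z s)) t (pairing (grd (z t)) zd).
Proof.
move=> It Sz Szd Dz z_dt; have Lg := grd_L2 (Dz _ It).
have subB := state_subB prod_state_linear; have subZ := state_subZ prod_state_linear.
have N0 : 0 <= sum_norm (grd (z t)) by exact: sum_norm_ge0.
have h1 : pairing (grd (z t)) ((s - t)^-1 *: (z s - z t)) @[s --> within I t^'] -->
    pairing (grd (z t)) zd.
  apply: (@cvg_le_norm _ _ _ _ (fun s =>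
    sum_norm (grd (z t)) * sum_norm ((s - t)^-1 *: (z s - z t) - zd))).
    near=> s; have Is : I s by near: s; exact: near_within.
    have Sq : S ((s - t)^-1 *: (z s - z t)).
      by apply: subZ; apply: subB; exact: Sz.
    rewrite -pairingBr//; [|exact: prod_state_L2|exact: prod_state_L2].
    by apply: pairing_le => //; apply: prod_state_L2; exact: subB.
  by rewrite -(mulr0 (sum_norm (grd (z t)))); apply: cvgM => //; exact: cvg_cst.
have h2 : (s - t)^-1 * (ell (z s) - ell (z t) - pairing (grd (z t)) (z s - z t))
    @[s --> within I t^'] --> (0 : R).
  apply/cvgrPdist_le => e e0.
  pose M := sum_norm zd + 1; have M0 : 0 < M by rewrite ltr_wpDl// sum_norm_ge0.
  (* The error is at most [eta] times the norm of the difference quotient, which is at most [M] near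
     [t]. *)
  have eta0 : 0 < e / M by rewrite divr_gt0.
  have [del del0 hdel] := near_state (Dz _ It) eta0.
  have near_del := near_sum_norm_increment mO prod_state_linear prod_state_L2 It Sz Szd
    z_dt del0.
  have near_M := near_sum_norm_quotient mO prod_state_linear prod_state_L2 It Sz Szd z_dt.
  near=> s; have Is : I s by near: s; exact: near_within.
  have Sd : S (z s - z t) by apply: subB; exact: Sz.
  have small : sum_norm (z s - z t) < del.
    by near: s.
  have qM : sum_norm ((s - t)^-1 *: (z s - z t)) <= M.
    by near: s.
  have := ell_increment Sd (fun k Sk kle => hdel k Sk (le_lt_trans kle small)).
  rewrite [z t + _]addrC subrK => inc.
  rewrite sub0r normrN normrM; apply: le_trans (ler_wpM2l (normr_ge0 _) inc) _.
  rewrite mulrCA -(sum_normZ mO); last exact: prod_state_L2.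
  by apply: le_trans (ler_wpM2l (ltW eta0) qM) _; rewrite divfK// gt_eqF.
rewrite /has_deriv_within -[X in _ --> X]add0r.
apply: cvg_trans (cvgD h2 h1); apply: near_eq_cvg; near=> s.
have Is : I s by near: s; exact: near_within.
have Sd : S (z s - z t) by apply: subB; exact: Sz.
rewrite fctE pairingZr//; last exact: prod_state_L2.
by rewrite -mulrDr subrK.
Unshelve. all: by end_near. Qed.

End chain_rule.

(** * Properties of the projector and assembly of the balances *)

Lemma form_a_diag (R : realType) (d : nat) (Omega : set 'rV[R]_d) (w u : vfield R d) :
  form_a Omega w u u = 0.
Proof.
rewrite /form_a /Rintegral integral0_eq ?oppr0// => x _.
rewrite big1// => i _; rewrite /bracket big1 ?mulr0// => j _.
by rewrite subrr.
Qed.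

Lemma dt_is_dt (R : realType) (d : nat) (Omega : set 'rV[R]_d) (I : set R)
    (f : R -> sfield R d) (t : R) (g : sfield R d) :
  is_dt Omega I f t g -> is_dt Omega I f t (dt Omega I f t).
Proof. by move=> fg; apply: (@getPex _ [set h | is_dt Omega I f t h]); exists g. Qed.

Section projector.
Variables (R : realType) (d : nat) (Omega : set 'rV[R]_d).
Hypothesis Omega_open : open Omega.
Variables (Th : triangulation Omega) (q : nat) (pi_h : sfield R d -> sfield R d).
Hypothesis pi_proj : L2_projector Th q pi_h.

Let mO : measurable Omega := open_rV_measurable Omega_open.

Lemma ip_projector f g : L2 Omega f -> Vh Th q g -> ip Omega (pi_h f) g = ip Omega f g.
Proof.
move=> Lf Vg; have [[Lpf _] /(_ g Vg)] := pi_proj Lf.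
rewrite (ipBl mO)//; last exact: Vg.1.
by move=> /eqP; rewrite subr_eq0 => /eqP.
Qed.

(** [f - pi_h f] lies in V_h and is orthogonal to V_h, hence to itself. *)
Lemma projector_id f : Vh Th q f -> aeq Omega (pi_h f) f.
Proof.
move=> Vf; have [Vpf ort] := pi_proj Vf.1.
have Vd : Vh Th q (f - pi_h f) by exact: VhB.
have := ip_eq0_aeq0 mO Vd.1 (ort _ Vd).
apply: filterS => x h Ox; have /eqP := h Ox.
by rewrite !fctE subr_eq0 => /eqP.
Qed.

End projector.

Lemma sum_norm_cvg0 (R : realType) (d : nat) (Omega : set 'rV[R]_d) (I : set R) (t : R)
    (u : R -> vfield R d) (rho s : R -> sfield R d)
    (u' : vfield R d) (rho' s' : sfield R d) :
  (forall i, is_dt Omega I (fun x => u x i) t (u' i)) ->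
  is_dt Omega I rho t rho' -> is_dt Omega I s t s' ->
  sum_norm Omega ((x - t)^-1 *: ((u x, rho x, s x) - (u t, rho t, s t) : state R d) -
    (u', rho', s')) @[x --> within I t^'] --> (0 : R).
Proof.
move=> hu [_ hrho] [_ hs].
have h1 : \sum_i L2norm Omega ((x - t)^-1 *: (u x i - u t i) - u' i)
    @[x --> within I t^'] --> (0 : R).
  have E : \sum_(i < d) (0 : R) = 0 by rewrite big1_eq.
  rewrite -[X in _ --> X]E.
  by apply: cvg_big => [|i _]; [exact: add_continuous|exact: (hu i).2].
have h := cvgD (cvgD h1 hrho) hs; rewrite !addr0 in h; exact: h.
Qed.

Lemma has_deriv_within_vip (R : realType) (d : nat) (Omega : set 'rV[R]_d)
    (mO : measurable Omega) (I : set R) (t : R) (f g : R -> vfield R d) (a b : vfield R d) :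
  I t -> (forall s i, I s -> L2 Omega (f s i)) -> (forall s i, I s -> L2 Omega (g s i)) ->
  (forall i, is_dt Omega I (fun s => f s i) t (a i)) ->
  (forall i, is_dt Omega I (fun s => g s i) t (b i)) ->
  has_deriv_within I (fun s => vip Omega (f s) (g s)) t
    (vip Omega a (g t) + vip Omega (f t) b).
Proof.
move=> It Lf Lg fa gb; rewrite /vip -big_split/=.
apply: has_deriv_within_sum => i.
by apply: (@has_deriv_within_ip _ _ _ mO I t It (fun s => f s i) (fun s => g s i)) => // s;
  [exact: Lf|exact: Lg].
Qed.

Theorem mainTheorem3 (R : realType) (d : nat) (hd : d = 2%N \/ d = 3%N)
  (Omega : set 'rV[R]_d)
  (Omega_open : open Omega) (Omega_connected : connected Omega)
  (Omega_nonempty : Omega !=set0) (Omega_bounded : bounded_set Omega)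
  (Th : triangulation Omega) (r q : nat) (hrq : (1 <= r <= q)%N)
  (pi_h : sfield R d -> sfield R d) (pi_proj : L2_projector Th q pi_h)
  (visc lambda : R) (hvisc : 0 <= visc)
  (hlambda : 0 <= lambda + 2 / d%:R * visc)
  (d_h : sfield R d -> sfield R d -> sfield R d -> R) (hd_h : form_d_spec Th q d_h)
  (e_h : sfield R d -> sfield R d -> R) (he_h : form_e_spec Th q e_h)
  (X : set (vfield R d)) (UX : Uh Th r `<=` X)
  (Y : set (sfield R d)) (VY : Vh Th q `<=` Y)
  (D : set (state R d))
  (D_open : open_in Omega (discrete_states Th r q) D)
  (ell : state R d -> R)
  (lu : state R d -> vfield R d) (lrho ls : state R d -> sfield R d)
  (ell_deriv : functional_derivatives Omega D X Y ell lu lrho ls)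
  (ell_smooth : smooth_derivatives Omega (discrete_states Th r q) D lu lrho ls)
  (t0 t1 : R) (t01 : t0 < t1)
  (u : R -> vfield R d) (rho s : R -> sfield R d)
  (u_smooth : smooth_vcurve Omega `[t0, t1]%classic (Uh Th r) u)
  (rho_smooth : smooth_curve Omega `[t0, t1]%classic (Vh Th q) rho)
  (s_smooth : smooth_curve Omega `[t0, t1]%classic (Vh Th q) s)
  (in_D : forall t, t0 <= t <= t1 -> D (u t, rho t, s t)) :
  let I : set R := `[t0, t1]%classic in
  let z t := (u t, rho t, s t) in
  let pi_u t := fun i => pi_h (lu (z t) i) in
  let pi_rho t := pi_h (lrho (z t)) in
  let pi_s t := pi_h (ls (z t)) in
  (forall t v, I t -> Uh Th r v ->
    vip Omega (fun i => dt Omega I (fun t' => lu (z t') i) t) v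
    + form_a Omega (pi_u t) (u t) v
    + form_b Th (pi_rho t) (rho t) v
    + form_b Th (pi_s t) (s t) v
    = - form_c Omega visc lambda (cst 1) (u t) v) ->
  (forall t theta, I t -> Vh Th q theta ->
    ip Omega (dt Omega I rho t) theta + form_b Th theta (rho t) (u t) = 0) ->
  (forall t w, I t -> Vh Th q w ->
    - ip Omega (dt Omega I s t) (pi_s t * w)
    - form_b Th (pi_h (pi_s t * w)) (s t) (u t)
    + d_h (cst 1) (- pi_s t) (pi_h (pi_s t * w))
    = form_c Omega visc lambda w (u t) (u t)
      + d_h w (- pi_s t) (pi_s t) - e_h w (- pi_s t)) ->
  forall t, I t ->
    has_deriv_within I
      (fun t' => vip Omega (lu (z t')) (u t') - ell (z t'))
      t (- e_h (cst 1) (- pi_s t)) /\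
    has_deriv_within I
      (fun t' => (\int[lebesgue_rV R d]_(x in Omega) rho t' x)%R) t 0.

Proof.
move=> I z pi_u pi_rho pi_s eq_u eq_rho eq_s t It.
have mO := open_rV_measurable Omega_open.
have d0 : (0 < d)%N by case: hd => ->.
have UL a v w := @Uh_linear _ _ _ Omega_open Omega_bounded Th r a v w.
have VL a f g := @Vh_linear _ _ _ Omega_open Th q a f g.
have U_L2 v : Uh Th r v -> forall i, L2 Omega (v i) by move=> hv i; exact: (hv i).1.1.
have V_L2 f : Vh Th q f -> L2 Omega f by case.
have [Fu [Fu0 Fu_dt]] := u_smooth; have [Frho [Frho0 Frho_dt]] := rho_smooth.
have [Fs [Fs0 Fs_dt]] := s_smooth.
have Uu x : I x -> Uh Th r (u x) by move=> Ix; rewrite -Fu0; exact: (Fu_dt 0%N x Ix).1.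
have Vrho x : I x -> Vh Th q (rho x).
  by move=> Ix; rewrite -Frho0; exact: (Frho_dt 0%N x Ix).1.
have Vs x : I x -> Vh Th q (s x) by move=> Ix; rewrite -Fs0; exact: (Fs_dt 0%N x Ix).1.
(* These representatives of the time derivatives are known to lie in the discrete spaces, whereas
   [dt] selects an arbitrary one. *)
set u' := Fu 1%N t; set rho' := Frho 1%N t; set s' := Fs 1%N t.
have Uu' : Uh Th r u' := (Fu_dt 1%N t It).1.
have Vrho' : Vh Th q rho' := (Frho_dt 1%N t It).1.
have Vs' : Vh Th q s' := (Fs_dt 1%N t It).1.
have dt_u i : is_dt Omega I (fun x => u x i) t (u' i).
  by rewrite -Fu0; exact: (Fu_dt 0%N t It).2.
have dt_rho : is_dt Omega I rho t rho' by rewrite -Frho0; exact: (Frho_dt 0%N t It).2.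
have dt_s : is_dt Omega I s t s' by rewrite -Fs0; exact: (Fs_dt 0%N t It).2.
have Dz x : I x -> D (z x) by rewrite /I /= in_itv /=; exact: in_D.
have Sz x : I x -> discrete_states Th r q (z x).
  by move=> Ix; exact: (conj (conj (Uu x Ix) (Vrho x Ix)) (Vs x Ix)).
pose zd : state R d := (u', rho', s').
have Szd : discrete_states Th r q zd by exact: (conj (conj Uu' Vrho') Vs').
have z_dt := sum_norm_cvg0 dt_u dt_rho dt_s.
have SL := prod_state_linear UL VL; have SL2 := prod_state_L2 U_L2 V_L2.
have Lgrd x : I x -> L2_state Omega (lu (z x), lrho (z x), ls (z x)).
  by move=> Ix; exact: (grd_L2 ell_deriv (Dz x Ix)).
(* Composing the Frechet derivative of [lu] with the curve shows that a derivative exists, so [dt]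
   is not a default value here. *)
have dt_lu i : is_dt Omega I (fun x => lu (z x) i) t
    (dt Omega I (fun x => lu (z x) i) t).
  have [/(_ i)[_ [L /(_ _ (Dz t It)) hL _]] _ _] := ell_smooth 1%N.
  apply: dt_is_dt; apply: (frechet_is_dt mO SL SL2 It Sz Szd z_dt _ hL) => x Ix.
  exact: (Lgrd x Ix).1.
have [lu_cont lrho_cont ls_cont] := ell_smooth 0%N.
have d_ell := has_deriv_within_ell mO UL VL U_L2 V_L2 UX VY ell_deriv D_open
  (fun i => (lu_cont i).1) lrho_cont.1 ls_cont.1 It Sz Szd Dz z_dt.
have d_vip := has_deriv_within_vip mO It (fun x i Ix => (Lgrd x Ix).1 i)
  (fun x i Ix => U_L2 _ (Uu x Ix) i) dt_lu dt_u.
have PF := within_dnbhs_itv_proper t01 It.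
have Vpi_rho : Vh Th q (pi_rho t) := (pi_proj _ (Lgrd t It).2.1).1.
have Vpi_s : Vh Th q (pi_s t) := (pi_proj _ (Lgrd t It).2.2).1.
have V1 : Vh Th q (cst 1) by exact: Vh_cst1.
(* Inner products do not distinguish [dt] from the representatives fixed above. *)
have ip_dt f f' g : (forall x, I x -> L2 Omega (f x)) -> is_dt Omega I f t f' ->
    L2 Omega g -> ip Omega (dt Omega I f t) g = ip Omega f' g.
  move=> Lf ff' Lg; have fdt := dt_is_dt ff'.
  apply: (ip_aeq mO fdt.1 ff'.1 Lg).
  exact: (is_dt_unique mO It PF Lf fdt ff').
split.
  have := has_deriv_withinD d_vip (has_deriv_withinN d_ell).
  congr (has_deriv_within _ _ _ _).
  have eq1 := eq_u t (u t) It (Uu t It).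
  have eq2 := eq_rho t (pi_rho t) It Vpi_rho.
  have eq3 := eq_s t (cst 1) It V1.
  rewrite form_a_diag in eq1.
  (* For w = 1 the projected product is [pi_s t] almost everywhere. After replacing it in b_h and
     d_h, the same value of d_h stands on both sides of the entropy equation. *)
  have pi1 : pi_s t * cst 1 = pi_s t by apply/funext => x; exact: mulr1.
  have pipi := projector_id Omega_open pi_proj Vpi_s.
  rewrite pi1 (form_b_aeq _ _ _ pipi) in eq3.
  have [d_aeq _ _] := hd_h.
  have VN : Vh Th q (- pi_s t) by exact: VhN.
  have aexx f : aeq Omega f f by exact: aeW.
  have dE := d_aeq (cst 1) (cst 1) (- pi_s t) (- pi_s t) (pi_h (pi_s t)) (pi_s t)
    V1 V1 VN VN (pi_proj _ Vpi_s.1).1 Vpi_s (aexx _) (aexx _) pipi.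
  rewrite dE in eq3.
  have e2 : ip Omega (dt Omega I rho t) (pi_rho t) = ip Omega (lrho (z t)) rho'.
    rewrite (ip_dt _ _ _ (fun x Ix => V_L2 _ (Vrho x Ix)) dt_rho Vpi_rho.1) ipC.
    exact: (ip_projector Omega_open pi_proj (Lgrd t It).2.1 Vrho').
  have e3 : ip Omega (dt Omega I s t) (pi_s t) = ip Omega (ls (z t)) s'.
    rewrite (ip_dt _ _ _ (fun x Ix => V_L2 _ (Vs x Ix)) dt_s Vpi_s.1) ipC.
    exact: (ip_projector Omega_open pi_proj (Lgrd t It).2.2 Vs').
  rewrite e2 in eq2; rewrite e3 in eq3.
  (* Once <dl/du, u'> has cancelled between product rule and chain rule, the claim is [eq1] minus
     [eq2] plus [eq3]: both b_h terms and c drop out. *)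
  rewrite /pairing /=; lra.
(* Total mass is the inner product with 1, and the density equation tested with 1 gives its
   derivative. *)
have <- : ip Omega (dt Omega I rho t) (cst 1) = 0.
  by rewrite -[LHS]addr0 -[X in _ + X](form_b_cst1 Th (rho t) (u t) d0); exact: eq_rho.
rewrite (_ : (fun x => _) = (fun x => ip Omega (rho x) (cst 1))); last first.
  by apply/funext => x; apply: eq_Rintegral => y _; rewrite mulr1.
apply: (has_deriv_within_ipl mO It _ V1.1 (dt_is_dt dt_rho)) => x Ix.
exact: (V_L2 _ (Vrho x Ix)).
Qed.
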